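(* Let $d$ be the dimension, $\epsilon = 1/d^4$, and $\delta\in[0,1]$. Any deterministic first-order algorithm (in the memory-constrained model below) that is guaranteed to minimize every $1$-Lipschitz convex function $f:\mathbb{R}^d\to\mathbb{R}$ over the unit ball $B_d(0,1)$ to accuracy $\epsilon$ either uses at least $d^{2-\delta}$ bits of memory, or makes $\tilde\Omega(d^{1+\delta/3})$ oracle queries (on some such function).
   Context: $B_d(\mathbf x,r)=\{\mathbf x'\in\mathbb{R}^d:\|\mathbf x-\mathbf x'\|_2\le r\}$. A first-order oracle for a convex $f$ returns, for each query $\mathbf x\in\mathbb{R}^d$, the pair $(f(\mathbf x),\mathbf g)$ with $\mathbf g$ a subgradient of $f$ at $\mathbf x$. An $M$-bit memory-constrained deterministic algorithm with access to an oracle $\mathcal O:\mathcal S\to\mathcal R$ is specified by a query function $\psi_{query}:\{0,1\}^M\to\mathcal S$ and an update function $\psi_{update}:\{0,1\}^M\times\mathcal S\times\mathcal R\to\{0,1\}^M$; it starts with memory $\mathsf{Memory}_0=0^M$, and at iteration $t$ it queries $q_t=\psi_{query}(\mathsf{Memory}_{t-1})$, receives $r_t=\mathcal O(q_t)$ and sets $\mathsf{Memory}_t=\psi_{update}(\mathsf{Memory}_{t-1},q_t,r_t)$ (internal computations are unrestricted in memory). It may stop at any iteration, and its last query is its output. The algorithm minimizes $f$ to accuracy $\epsilon$ if its output $\tilde{\mathbf x}\in B_d(0,1)$ satisfies $f(\tilde{\mathbf x})\le\min_{\mathbf x\in B_d(0,1)}f(\mathbf x)+\epsilon$. The notation $\tilde\Omega(\cdot)$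 hides universal constants and polylogarithmic factors in $d$ (the statement is asymptotic in $d$). *)

(* Defs.v *)
From mathcomp Require Import all_boot.
From Stdlib Require Import Reals.

Set Implicit Arguments.
Unset Strict Implicit.
Unset Printing Implicit Defensive.

Local Open Scope R_scope.

Definition vec (d : nat) := 'I_d -> R.

Definition vsub d (x y : vec d) : vec d := fun i => x i - y i.
Definition dot d (x y : vec d) : R := \big[Rplus/R0]_(i < d) (x i * y i).
Definition norm2 d (x : vec d) : R := sqrt (dot x x).
Definition in_unit_ball d (x : vec d) : Prop := norm2 x <= 1.

Definition convex_fun d (f : vec d -> R) : Prop :=
  forall (x y : vec d) (t : R), 0 <= t <= 1 ->
    f (fun i => t * x i + (1 - t) * y i) <= t * f x + (1 - t) * f y.

Definition lipschitz1 d (f : vec d -> R) : Prop :=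
  forall x y : vec d, Rabs (f x - f y) <= norm2 (vsub x y).

Definition is_subgradient d (f : vec d -> R) (x g : vec d) : Prop :=
  forall y : vec d, f y >= f x + dot g (vsub y x).

Definition first_order_oracle d (f : vec d -> R) (O : vec d -> R * vec d) : Prop :=
  forall x, fst (O x) = f x /\ is_subgradient f x (snd (O x)).

(* M-bit memory-constrained deterministic algorithm.  [halt] decides, from
   the current memory state, whether to stop after the current iteration. *)
Record alg (d M : nat) := Alg {
  psi_query : M.-tuple bool -> vec d;
  psi_update : M.-tuple bool -> vec d -> R * vec d -> M.-tuple bool;
  psi_halt : M.-tuple bool -> bool
}.

Definition mem0 (M : nat) : M.-tuple bool := nseq_tuple M false.

Fixpoint memory d M (A : alg d M) (O : vec d -> R * vec d) (t : nat)
  : M.-tuple bool :=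
  match t with
  | O => mem0 M
  | S t' => let m := memory A O t' in
            psi_update A m (psi_query A m) (O (psi_query A m))
  end.

(* q_t, for t >= 1 *)
Definition query_at d M (A : alg d M) (O : vec d -> R * vec d) (t : nat) : vec d :=
  psi_query A (memory A O t.-1).

(* The algorithm stops at iteration T >= 1 (having made exactly T queries). *)
Definition stops_at d M (A : alg d M) (O : vec d -> R * vec d) (T : nat) : Prop :=
  (1 <= T)%nat /\ psi_halt A (memory A O T) = true /\
  forall t, (1 <= t)%nat -> (t < T)%nat -> psi_halt A (memory A O t) = false.

Definition minimizes_all d M (A : alg d M) (eps : R) : Prop :=
  forall (f : vec d -> R) (O : vec d -> R * vec d),
    convex_fun f -> lipschitz1 f -> first_order_oracle f O ->
    exists T, stops_at A O T /\ in_unit_ball (query_at A O T) /\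
      forall y : vec d, in_unit_ball y -> f (query_at A O T) <= f y + eps.

(* Main.v *)
(* Split the coordinates as x = (u, z) with u in R^b and z in R^n.  For a sign
   matrix (a_i) of size n * b, the hard function is the maximum of (|x| - 1) / 2,
   of the row terms |lam a_i.u + z_i / 2| - mu and of slowly decreasing terms
   mu (v_l.u - l gam) along nearly orthonormal directions v_l, chosen adaptively.
   A query at which no row term dominates is almost orthogonal to all rows;
   when it is also at distance more than tau from the span of the earlier such
   queries, it is called exploring, and a new direction orthogonal to all
   exploring queries and to the previous directions is added.  As long as fewer
   than K directions have been added, the minimum stays well below all values
   seen, so every run contains K exploring queries.

   Cut these into p blocks of k; some block takes at most m steps, where p m
   bounds the length of the run.  The memory at the beginning of that block, the
   list of directions (rounded to a grid) and the rows revealed in the block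
   determine its queries.  The k exploring ones among them are robustly
   independent and almost orthogonal to each of the remaining n - m rows, which
   costs each of these rows q = k / O(log d) bits of freedom.  As there are
   2^(nb) matrices, q (n - m) is at most the memory plus the description length
   of the other data, which fails for p about d^(delta/3). *)

Require Import Defs.
From Stdlib Require Import Reals.
From mathcomp Require Import all_boot all_order all_algebra.
From mathcomp Require Import boolp reals Rstruct.
From mathcomp Require Import ring lra zify.

Module Tradeoff.

Set Implicit Arguments.
Unset Strict Implicit.
Unset Printing Implicit Defensive.
Import Order.TTheory GRing.Theory Num.Theory.
Local Open Scope ring_scope.
Bind Scope ring_scope with R.

(** * Sign vectors almost orthogonal to robustly independent vectors *)

Lemma cauchy_schwarz_sum (F : realFieldType) (I : finType) (x y : I -> F) :
  (\sum_i x i * y i) ^+ 2 <= (\sum_i x i ^+ 2) * (\sum_i y i ^+ 2).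
Proof.
have [nwz|nwnz] := eqVneq (\sum_i y i ^+ 2) 0.
  rewrite big1 ?expr0n ?nwz ?mulr0 //= => c _.
  have /eqP := nwz; rewrite psumr_eq0 => [/allP/(_ c)|? _]; last exact: sqr_ge0.
  by rewrite mem_index_enum => /(_ isT); rewrite sqrf_eq0 => /eqP->; rewrite mulr0.
have nw0 : 0 <= \sum_i y i ^+ 2 by apply: sumr_ge0 => c _; apply: sqr_ge0.
have nwp : 0 < \sum_i y i ^+ 2 by rewrite lt_def nwnz.
have key (a e : F) : \sum_c (a * x c - e * y c) ^+ 2 =
    a ^+ 2 * (\sum_i x i ^+ 2) - 2 * a * e * (\sum_c x c * y c) + e ^+ 2 * (\sum_i y i ^+ 2).
  by rewrite !mulr_sumr -sumrB -big_split /=; apply: eq_bigr => c _; ring.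
have : 0 <= \sum_c ((\sum_i y i ^+ 2) * x c - (\sum_c x c * y c) * y c) ^+ 2.
  by apply: sumr_ge0 => c _; apply: sqr_ge0.
rewrite key; move: (\sum_i y i ^+ 2) nwp (\sum_i x i ^+ 2) (\sum_i x i * y i) => Y Yp X s h.
have : 0 <= Y * (X * Y - s ^+ 2) by apply: le_trans h _; nra.
by rewrite pmulr_rge0 // subr_ge0.
Qed.

Lemma sqr_sum_abs_le (F : realFieldType) m (x : 'I_m -> F) :
  (\sum_i `|x i|) ^+ 2 <= m%:R * \sum_i x i ^+ 2.
Proof.
have := cauchy_schwarz_sum (fun i => 1) (fun i => `|x i|).
under eq_bigr do rewrite mul1r; under [X in _ <= X * _]eq_bigr do rewrite expr1n.
rewrite sumr_const card_ord.
by under [X in _ <= _ * X]eq_bigr do rewrite real_normK ?num_real //.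
Qed.


(** * Hadamard's inequality for determinants over an ordered field *)

Section Hadamard.
Variable F : realFieldType.

Definition rnorm2 k (M : 'M[F]_k) (i : 'I_k) : F := \sum_j M i j ^+ 2.

Lemma rnorm2_ge0 k (M : 'M[F]_k) i : 0 <= rnorm2 M i.
Proof. by apply: sumr_ge0 => j _; apply: sqr_ge0. Qed.

(** These sums are the off-diagonal entries of [M *m \adj M]. *)
Lemma cofactor_orthogonal k (M : 'M[F]_k) (i j : 'I_k) :
  i != j -> \sum_c M j c * cofactor M i c = 0.
Proof.
move=> ij; have := congr1 (fun A : 'M_k => A j i) (mul_mx_adj M).
rewrite !mxE eq_sym (negbTE ij) mulr0n => {2}<-.
by apply: eq_bigr => c _; rewrite !mxE.
Qed.

Lemma hadamard_orthogonal k (M : 'M[F]_k) :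
  (forall i j, i != j -> \sum_c M i c * M j c = 0) ->
  \det M ^+ 2 = \prod_i rnorm2 M i.
Proof.
move=> orth; rewrite expr2 -{2}det_tr -det_mulmx.
have -> : M *m M^T = diag_mx (\row_i rnorm2 M i).
  apply/matrixP => i j; rewrite !mxE.
  under eq_bigr do rewrite mxE.
  have [<-|ij] := eqVneq i j; last by rewrite orth.
  by rewrite mulr1n; apply: eq_bigr => c _; rewrite expr2.
by rewrite det_diag; apply: eq_bigr => i _; rewrite mxE.
Qed.

(* Replacing row [t] by its cofactor row makes it orthogonal to all others. *)
Lemma hadamard_step k (M : 'M[F]_k) t : (t <= k)%N ->
  (forall i j : 'I_k, (i < t)%N -> i != j -> \sum_c M i c * M j c = 0) ->
  \det M ^+ 2 <= \prod_i rnorm2 M i.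
Proof.
(* Induction on the number of rows not yet known to be orthogonal to all others. *)
move: {2}(k - t)%N (erefl (k - t)%N) => m; elim: m t M => [|m IH] t M mE tk orth.
  rewrite hadamard_orthogonal // => i j ij; apply: orth => //.
  by apply: leq_trans (ltn_ord i) _; lia.
have tk' : (t < k)%N by lia.
pose i0 := Ordinal tk'.
pose w := \row_c cofactor M i0 c.
pose M' := \matrix_(i, c) if i == i0 then w 0 c else M i c.
pose nw := \sum_c w 0 c ^+ 2.
have nw0 : 0 <= nw by apply: sumr_ge0 => c _; apply: sqr_ge0.
have cofM' c : cofactor M' i0 c = cofactor M i0 c.
  rewrite /cofactor; congr (_ * \det _); apply/matrixP => i j.
  by rewrite !mxE eq_sym (negbTE (neq_lift _ _)).
have detM' : \det M' = nw.
  rewrite (expand_det_row _ i0); apply: eq_bigr => c _.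
  by rewrite cofM' !mxE eqxx expr2.
have detM : \det M = \sum_c M i0 c * w 0 c.
  by rewrite (expand_det_row _ i0); apply: eq_bigr => c _; rewrite !mxE.
have CS : \det M ^+ 2 <= rnorm2 M i0 * nw.
  by rewrite detM; apply: cauchy_schwarz_sum.
have rM' i : i != i0 -> rnorm2 M' i = rnorm2 M i.
  by move=> ni; apply: eq_bigr => c _; rewrite !mxE (negbTE ni).
have rM'0 : rnorm2 M' i0 = nw by apply: eq_bigr => c _; rewrite !mxE eqxx.
have orthw j : j != i0 -> \sum_c M j c * w 0 c = 0.
  move=> ji; rewrite -[RHS](@cofactor_orthogonal _ M i0 j); last by rewrite eq_sym.
  by apply: eq_bigr => c _; rewrite !mxE.
have := IH t.+1 M' _ tk' _.
rewrite detM' (bigD1 i0) //= rM'0 (eq_bigr _ rM').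
set P := \prod_(i | _) _ => Hle.
have P0 : 0 <= P by apply: prodr_ge0 => i _; apply: rnorm2_ge0.
(* [M'] has one more orthogonal row, so the induction hypothesis covers it. Dividing by [nw] gives
   [nw <= P], which is then inserted in [CS]. *)
have {Hle} Hle : nw ^+ 2 <= nw * P.
  apply: Hle; first by lia.
  move=> i j; rewrite ltnS leq_eqVlt => /orP[/eqP it|it] ij.
    have -> : i = i0 by apply: val_inj.
    rewrite -[RHS](orthw j); last by rewrite eq_sym; apply: contraNneq ij => <-; apply/eqP/val_inj.
    apply: eq_bigr => c _; rewrite !mxE eqxx.
    case: eqP => [e|_]; last by rewrite mulrC.
    by case/eqP: ij; rewrite e; apply: val_inj.
  have ii0 : i != i0 by rewrite -val_eqE /= neq_ltn it.
  have [ji|ji] := eqVneq j i0.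
    rewrite -[RHS](orthw i ii0); apply: eq_bigr => c _.
    by rewrite !mxE (negbTE ii0) ji eqxx.
  rewrite -[RHS](orth i j it ij); apply: eq_bigr => c _.
  by rewrite !mxE (negbTE ii0) (negbTE ji).
rewrite (bigD1 i0) //= -/P; apply: le_trans CS _.
apply: ler_wpM2l; first exact: rnorm2_ge0.
have [->//|nwnz] := eqVneq nw 0.
by rewrite -(@ler_pM2l _ nw) -?expr2 // lt_def nwnz.
Qed.

Lemma hadamard k (M : 'M[F]_k) : \det M ^+ 2 <= \prod_i rnorm2 M i.
Proof. exact: (@hadamard_step _ M 0). Qed.

End Hadamard.

(** * Large minors, and sign vectors close to an affine subspace *)

Section Minor.
Variable F : realFieldType.

(** Multilinear expansion in the rows of [W]: the Cauchy-Binet formula before the injective [f] are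
    grouped by their image. *)
Lemma det_mul_tr_sum k b (W U : 'M[F]_(k, b)) :
  \det (W *m U^T) =
  \sum_(f : {ffun 'I_k -> 'I_b})
     (\prod_j W j (f j)) * \det (\matrix_(i, j) U i (f j)).
Proof.
rewrite [LHS]/determinant.
under eq_bigr => s _.
  under eq_bigr => j _.
    rewrite mxE. under eq_bigr do rewrite mxE.
  over.
  rewrite bigA_distr_bigA /= mulr_sumr.
over.
rewrite exchange_big /=; apply: eq_bigr => f _.
rewrite -det_tr [in RHS]/determinant mulr_sumr; apply: eq_bigr => s _.
rewrite big_split /= mulrCA; congr (_ * (_ * _)).
by apply: eq_bigr => j _; rewrite !mxE.
Qed.

(* [W *m U^T] is triangular with large diagonal; expanding its determinant over
   the choices of one column per row exhibits the minor. *)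
Lemma large_minor k b (W U : 'M[F]_(k, b)) tau : (0 < b)%N -> 0 < tau ->
  (forall j, \sum_c W j c ^+ 2 <= 1) ->
  (forall i j : 'I_k, (i < j)%N -> \sum_c W j c * U i c = 0) ->
  (forall j, tau <= \sum_c W j c * U j c) ->
  exists f : {ffun 'I_k -> 'I_b},
    tau ^+ (2 * k) <= b%:R ^+ k * \det (\matrix_(i, j) U i (f j)) ^+ 2.
Proof.
case: b W U => // b W U _ tau0 W1 orth diag.
pose dt (f : {ffun 'I_k -> 'I_b.+1}) := `|\det (\matrix_(i, j) U i (f j))|.
pose f := [arg max_(f > [ffun=> ord0]) dt f]%O.
have fmax g : dt g <= dt f.
  by rewrite /f; case: arg_maxP => // h _ /(_ g isT).
exists f.
have tri : is_trig_mx (W *m U^T)^T.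
  apply/is_trig_mxP => i j ij; rewrite !mxE -[RHS](orth i j ij).
  by apply: eq_bigr => c _; rewrite mxE.
have detge : tau ^+ k <= `|\det (W *m U^T)|.
  rewrite -det_tr (det_trig tri); apply: le_trans (ler_norm _).
  have -> : tau ^+ k = \prod_(i < k) tau by rewrite prodr_const card_ord.
  apply: ler_prod => j _; rewrite ltW //=.
  rewrite !mxE; apply: le_trans (diag j) _.
  by rewrite le_eqVlt; apply/orP; left; apply/eqP/eq_bigr => c _; rewrite mxE.
(* Bounding every minor by the largest one leaves the product of the l1 norms of the rows of [W];
   their squares are at most [b], hence the factor [b ^ k]. *)
have detle : `|\det (W *m U^T)| <= dt f * \prod_j \sum_c `|W j c|.
  rewrite det_mul_tr_sum bigA_distr_bigA /= mulr_sumr.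
  apply: le_trans (ler_norm_sum _ _ _) _; apply: ler_sum => g _.
  rewrite normrM normr_prod mulrC; apply: ler_wpM2r; first by rewrite prodr_ge0.
  exact: fmax.
rewrite mulnC exprM; apply: (@le_trans _ _ ((dt f * \prod_j \sum_c `|W j c|) ^+ 2)).
  have h := le_trans detge detle.
  have h0 : 0 <= tau ^+ k by rewrite exprn_ge0 // ltW.
  by apply: lerXn2r => //; rewrite nnegrE // (le_trans h0).
rewrite exprMn /dt real_normK ?num_real // mulrC; apply: ler_wpM2r; first exact: sqr_ge0.
have -> : b.+1%:R ^+ k = \prod_(i < k) b.+1%:R :> F by rewrite prodr_const card_ord.
rewrite -prodrXl; apply: ler_prod => j _.
rewrite sqr_ge0 /=; apply: le_trans (sqr_sum_abs_le _) _.
by rewrite -[leRHS]mulr1; apply: ler_wpM2l.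
Qed.

(* If the differences of elements of [P], whose entries are 0 and +-1, span a
   space of dimension [r], then [#|P| <= 2 ^ r].  Completing [r] independent
   differences by unit vectors gives an invertible integer matrix, whose
   determinant is at least 1 in absolute value; Hadamard's inequality for its
   product with [X^T] then bounds [r]. *)
Lemma card_sign_vectors_near_affine k q (X : 'M[F]_k) eta
    (P : {set {ffun 'I_k -> bool}}) :
  (q <= k)%N -> 0 <= eta <= 1 ->
  (forall i j, `|X i j| <= 2) ->
  (forall a a', a \in P -> a' \in P -> forall i,
     `|\sum_j X i j * ((a j)%:R - (a' j)%:R)| <= eta) ->
  (4 * k%:R) ^+ k * eta ^+ (2 * (k - q)) < \det X ^+ 2 ->
  (#|P| <= 2 ^ (k - q))%N.
Proof.
move=> qk /andP[eta0 eta1] X2 near big.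
have [->|[a0 a0P]] := set_0Vmem P; first by rewrite cards0.
pose Dm : 'M[F]_(#|P|, k) := \matrix_(p, j) ((@enum_val _ (mem P) p j)%:R - (a0 j)%:R).
pose r := \rank Dm.
pose W := rowsub (maxrankfun Dm) Dm.
have Wfree : row_free W by exact: maxrowsub_free.
have Wfull : row_full W^T by rewrite /row_full mxrank_tr; exact: Wfree.
have [J Jinj WJunit] : exists2 J : 'I_r -> 'I_k, injective J & rowsub J W^T \in unitmx.
  exists (fullrankfun Wfull); first exact: fullrankfun_inj.
  by rewrite -row_full_unit; exact: fullrowsub_full.
pose res (a : {ffun 'I_k -> bool}) := [ffun l : 'I_r => a (J l)].
(* A difference that vanishes on the columns [J] is a combination of the rows of [W] whose
   coefficients are killed by an invertible matrix. *)
have resinj : {in P &, injective res}.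
  move=> a a' aP a'P eqr.
  pose w : 'rV[F]_k := \row_j ((a j)%:R - (a' j)%:R).
  have rowDm x (xP : x \in P) : (\row_j ((x j)%:R - (a0 j)%:R) : 'rV[F]_k) = row (enum_rank_in a0P x) Dm.
    by apply/rowP => j; rewrite !mxE enum_rankK_in.
  have wW : (w <= W)%MS.
    rewrite eq_maxrowsub.
    have -> : w = \row_j ((a j)%:R - (a0 j)%:R) - \row_j ((a' j)%:R - (a0 j)%:R).
      by apply/rowP => j; rewrite !mxE; ring.
    by rewrite !rowDm // addmx_sub ?eqmx_opp ?row_sub.
  have [c wc] := submxP wW.
  have cJ : c *m (rowsub J W^T)^T = 0.
    apply/rowP => l; have := congr1 (fun v : 'rV_k => v 0 (J l)) wc.
    rewrite !mxE => h; move/ffunP/(_ l): eqr; rewrite !ffunE => e.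
    rewrite e subrr in h; rewrite [RHS]h; apply: eq_bigr => m _.
    by rewrite !mxE.
  have c0 : c = 0.
    have u : (rowsub J W^T)^T \in unitmx by rewrite unitmx_tr.
    by rewrite -[c](mulmxK u) cJ mul0mx.
  apply/ffunP => j; move/rowP/(_ j): wc; rewrite c0 mul0mx !mxE.
  by case: (a j) (a' j) => [] [] //= /eqP; rewrite ?subr0 ?sub0r ?oppr_eq0 oner_eq0.
have Pr : (#|P| <= 2 ^ r)%N.
  rewrite -(card_in_imset resinj); apply: leq_trans (max_card _) _.
  by rewrite card_ffun card_bool card_ord.
have [rk|rk] := leqP r (k - q); first by apply: leq_trans Pr _; rewrite leq_exp2l.
suff : \det X ^+ 2 <= (4 * k%:R) ^+ k * eta ^+ (2 * (k - q)) by rewrite leNgt big.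
(* Row [J l] is the [l]-th independent difference, every other row a unit vector. Integer entries
   give [detW']. *)
pose Wz : 'M[int]_k := \matrix_(i, j)
  if [pick l | J l == i] is Some l
  then ((@enum_val _ (mem P) (maxrankfun Dm l) j : nat)%:Z - (a0 j : nat)%:Z) else (i == j : nat)%:Z.
pose W' : 'M[F]_k := map_mx intr Wz.
have W'J l j : W' (J l) j = W l j.
  rewrite !mxE; case: pickP => [l' /eqP/Jinj ->|/(_ l)]; last by rewrite eqxx.
  by rewrite rmorphB /= !pmulrn.
have W'N i j : i \notin codom J -> W' i j = (i == j)%:R.
  move=> iJ; rewrite !mxE; case: pickP => [l /eqP e|_]; last by rewrite pmulrn.
  by rewrite -e codom_f in iJ.
have W'unit : W' \in unitmx.
  rewrite -unitmx_tr -row_free_unit; apply/row_freeP.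
  have inj (v : 'rV[F]_k) : v *m W'^T = 0 -> v = 0.
    move=> v0.
    have vN i : i \notin codom J -> v 0 i = 0.
      move=> iJ; move/rowP/(_ i): v0; rewrite !mxE (bigD1 i) //= mxE W'N // eqxx mulr1.
      rewrite big1 ?addr0 // => c ci; rewrite mxE W'N //.
      by rewrite eq_sym (negbTE ci) mulr0.
    pose vJ := \row_l v 0 (J l).
    have vJ0 : vJ *m (rowsub J W^T) = 0.
      apply/rowP => l; move/rowP/(_ (J l)): v0; rewrite !mxE => h.
      rewrite -[RHS]h [RHS](bigID (mem (codom J))) /= [X in _ + X]big1 ?addr0; last first.
        by move=> c cJ; rewrite vN ?mul0r.
      rewrite [RHS](eq_bigl (fun i => i \in J @: setT)); last first.
        move=> i; apply/idP/imsetP => [/codomP[x ->]|[x _ ->]]; [by exists x| exact: codom_f].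
      rewrite [RHS]big_imset /=; last by move=> x y _ _; exact: Jinj.
      apply: eq_big => [c|c _]; first by rewrite inE.
      by rewrite [vJ _ _]mxE [rowsub _ _ _ _]mxE [W^T _ _]mxE -W'J [W'^T _ _]mxE.
    have vJz : vJ = 0 by rewrite -[vJ](mulmxK WJunit) vJ0 mul0mx.
    apply/rowP => i; rewrite mxE; have [/codomP[l ->]|/vN//] := boolP (i \in codom J).
    by move/rowP/(_ l): vJz; rewrite !mxE.
  apply/row_freeP/inj_row_free => v; exact: inj.
have detW' : 1 <= \det W' ^+ 2.
  rewrite /W' det_map_mx -rmorphXn /= -[1]/(1%:~R) ler_int.
  move: W'unit; rewrite unitmxE unitfE /W' det_map_mx intr_eq0.
  by case: (\det Wz) => [[|m]|m] //= _; rewrite expr2; nia.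
pose M := W' *m X^T.
have M1 : \det X ^+ 2 <= \det M ^+ 2.
  rewrite det_mulmx det_tr exprMn -[leLHS]mul1r; apply: ler_wpM2r => //; exact: sqr_ge0.
apply: le_trans M1 _; apply: le_trans (hadamard _) _.
(* In [M], a difference row has entries at most [eta] by [near], a unit row entries at most 2 by
   [X2]. *)
apply: (@le_trans _ _ (\prod_i ((4 * k%:R) * (if i \in codom J then eta ^+ 2 else 1)))).
  apply: ler_prod => i _; rewrite rnorm2_ge0 /=.
  have -> : 4 * k%:R * (if i \in codom J then eta ^+ 2 else 1) =
     \sum_(j < k) (4 * (if i \in codom J then eta ^+ 2 else 1)) :> F.
    by rewrite sumr_const card_ord -mulr_natr; ring.
  apply: ler_sum => j _.
  rewrite -(real_normK (num_real _)) !mxE; case: ifP => [/codomP[l ->]|/negbT iJ].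
    have -> : \sum_c W' (J l) c * X^T c j =
       \sum_c X j c * ((@enum_val _ (mem P) (maxrankfun Dm l) c)%:R - (a0 c)%:R).
      by apply: eq_bigr => c _; rewrite W'J !mxE mulrC.
    have h := near _ _ (enum_valP (maxrankfun Dm l)) a0P j.
    apply: (@le_trans _ _ (eta ^+ 2)); first by rewrite ler_sqr ?nnegrE.
    by have := sqr_ge0 eta; lra.
  rewrite (bigD1 i) //= W'N // eqxx mul1r big1 ?addr0; last first.
    by move=> c ci; rewrite W'N // eq_sym (negbTE ci) mul0r.
  rewrite mxE mulr1; have := X2 j i; have := normr_ge0 (X j i).
  by move: `|X j i| => t; nra.
rewrite big_split /= prodr_const card_ord; apply: ler_wpM2l.
  by apply: exprn_ge0; apply: mulr_ge0.
(* There are [r > k - q] factors [eta ^ 2], and [eta <= 1]. *)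
rewrite -big_mkcond /= prodr_const (card_codom Jinj) card_ord -exprM.
by apply: ler_wiXn2l => //; rewrite leq_mul2l /= ltnW.
Qed.

End Minor.

(** [C] is partitioned by the restriction to [Rs], which takes at most [#|T| ^ #|Rs|] values. *)
Lemma card_le_fibers (I T : finType) (C : {set {ffun I -> T}}) (Rs : {set I}) B :
  (forall A0, A0 \in C ->
     #|[set A in C | [forall i in Rs, A i == A0 i]]| <= B)%N ->
  (#|C| <= #|T| ^ #|Rs| * B)%N.
Proof.
move=> fib.
pose h (A : {ffun I -> T}) : {ffun {x : I | x \in Rs} -> T} := [ffun x => A (val x)].
rewrite -sum1_card (partition_big h predT) //=.
apply: (@leq_trans (\sum_(y : {ffun {x : I | x \in Rs} -> T}) B)); last first.
  rewrite sum_nat_const card_ffun card_sig leq_mul2r.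
  by rewrite (eq_card (_ : _ =i Rs)) ?leqnn ?orbT // => x; rewrite !inE.
apply: leq_sum => y _.
have [A0 /andP[A0C /eqP hA0]|none] := pickP (fun A => (A \in C) && (h A == y)).
  rewrite sum1_card; apply: leq_trans (fib A0 A0C); apply: subset_leq_card.
  apply/subsetP => A /andP[AinC /eqP hA]; rewrite inE AinC /=.
  apply/forall_inP => i iin; apply/eqP.
  by move: hA; rewrite -hA0 => /ffunP/(_ (Sub i iin)); rewrite !ffunE.
by rewrite big1 // => A /andP[AinC hA]; move: (none A); rewrite /= AinC hA.
Qed.

Definition sgb (F : pzRingType) (c : bool) : F := if c then 1 else -1.

Lemma sgbB (F : realFieldType) (c c' : bool) :
  sgb F c - sgb F c' = 2 * (c%:R - c'%:R).
Proof. by case: c c' => [] [] /=; rewrite /sgb /=; ring. Qed.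

Lemma sqr_sgb (F : realFieldType) (c : bool) : sgb F c ^+ 2 = 1.
Proof. by case: c; rewrite /sgb ?expr1n ?sqrrN ?expr1n. Qed.

(* The coordinates outside a large [k * k] minor of [U] are fixed, which leaves
   an instance of [card_sign_vectors_near_affine]. *)
Lemma card_signs_in_slabs (F : realFieldType) b k q (U W : 'M[F]_(k, b)) tau eta
    (z : 'I_k -> F) :
  (0 < b)%N -> (q <= k)%N -> 0 < tau -> 0 <= eta <= 1 ->
  (forall i c, `|U i c| <= 2) ->
  (forall j, \sum_c W j c ^+ 2 <= 1) ->
  (forall i j : 'I_k, (i < j)%N -> \sum_c W j c * U i c = 0) ->
  (forall j, tau <= \sum_c W j c * U j c) ->
  (4 * k%:R * b%:R) ^+ k * eta ^+ (2 * (k - q)) < tau ^+ (2 * k) ->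
  (#|[set a : {ffun 'I_b -> bool} |
      [forall i, (`|\sum_c U i c * sgb F (a c) + z i| <= eta)%R]]| <= 2 ^ (b - q))%N.
Proof.
move=> b0 qk tau0 eta01 U2 W1 orth diag small.
have [f fbig] := large_minor b0 tau0 W1 orth diag.
set X := \matrix_(i, j) U i (f j) in fbig.
have bk0 : 0 < (b%:R : F) ^+ k by rewrite exprn_gt0 ?ltr0n.
have detX : (4 * k%:R) ^+ k * eta ^+ (2 * (k - q)) < \det X ^+ 2.
  rewrite -(ltr_pM2l bk0); apply: lt_le_trans fbig.
  by apply: le_lt_trans small; rewrite mulrA -exprMn [b%:R * _]mulrC.
(* A repeated column would make the minor vanish, against [detX]; hence also [k <= b]. *)
have finj : injective f.
  move=> i j fij; apply/eqP; apply: contraT => ij.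
  have : \det X = 0.
    rewrite -det_tr; apply: (determinant_alternate ij) => c.
    by rewrite !mxE fij.
  move=> dX; move: detX; rewrite dX expr0n /= ltNge mulr_ge0 //.
    by rewrite exprn_ge0 // mulr_ge0.
  by rewrite exprn_ge0 //; case/andP: eta01.
have kb : (k <= b)%N by have := leq_card f finj; rewrite !card_ord.
pose im := f @: [set: 'I_k].
have cim : #|~: im| = (b - k)%N.
  by rewrite cardsCs setCK card_ord card_imset // cardsT card_ord.
set V := [set a | _].
have -> : (2 ^ (b - q) = #|{: bool}| ^ #|~: im| * 2 ^ (k - q))%N.
  by rewrite card_bool cim -expnD; congr (2 ^ _)%N; lia.
apply: card_le_fibers => A0 A0V.
set Fb := [set A in V | _].
pose h (a : {ffun 'I_b -> bool}) := [ffun j : 'I_k => a (f j)].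
have off a a' c : a \in Fb -> a' \in Fb -> c \notin im -> a c = a' c.
  rewrite ![_ \in Fb]inE => /andP[_ /forall_inP ha] /andP[_ /forall_inP ha'] ci.
  by rewrite (eqP (ha c _)) ?(eqP (ha' c _)) // inE.
have hinj : {in Fb &, injective h}.
  move=> a a' aF a'F /ffunP e; apply/ffunP => c.
  have [/imsetP[j _ ->]|ci] := boolP (c \in im); last exact: off.
  by have := e j; rewrite !ffunE.
rewrite -(card_in_imset hinj).
apply: (card_sign_vectors_near_affine qk eta01 (X := X)) => //.
  by move=> i j; rewrite mxE.
move=> _ _ /imsetP[a aF ->] /imsetP[a' a'F ->] i.
(* The difference of two members loses the offset [z] and the coordinates outside [im]; the factor 2
   absorbs the full slab width [2 * eta]. *)
have sumE : \sum_c U i c * sgb F (a c) - \sum_c U i c * sgb F (a' c) =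
    2 * \sum_j X i j * ((h a j)%:R - (h a' j)%:R).
  rewrite -sumrB (bigID (mem im)) /= [X in _ + X]big1 ?addr0; last first.
    by move=> c ci; rewrite (off a a') // subrr.
  rewrite big_imset /=; last by move=> x y _ _; exact: finj.
  rewrite mulr_sumr; apply: eq_big => [j|j _]; first by rewrite inE.
  by rewrite !mxE !ffunE -mulrBr sgbB; ring.
have inV x : x \in Fb -> `|\sum_c U i c * sgb F (x c) + z i| <= eta.
  by rewrite inE => /andP[]; rewrite inE => /forallP/(_ i).
have := inV a aF; have := inV a' a'F.
move: sumE; rewrite !ler_norml => sumE /andP[h1 h2] /andP[h3 h4].
by apply/andP; split; lra.
Qed.

(** * Maxima of affine pieces *)

Section Euclidean.
Variable d : nat.
Implicit Types x y z : vec d.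

(** The definitions use the standard library operations; the ring structure on [R] is convertible to
    them. *)
Lemma dotE x y : dot x y = \sum_i x i * y i.
Proof. by []. Qed.

Lemma vsubE x y i : vsub x y i = x i - y i.
Proof. by []. Qed.

Lemma dotC x y : dot x y = dot y x.
Proof. by rewrite !dotE; apply: eq_bigr => i _; rewrite mulrC. Qed.

Lemma dot_ge0 x : 0 <= dot x x.
Proof. by rewrite dotE; apply: sumr_ge0 => i _; rewrite -expr2 sqr_ge0. Qed.

Lemma norm2_ge0 x : 0 <= norm2 x.
Proof. by apply/RleP/sqrt_pos. Qed.

Lemma sqr_norm2 x : norm2 x ^+ 2 = dot x x.
Proof. by rewrite expr2; apply: sqrt_sqrt; apply/RleP/dot_ge0. Qed.

Lemma norm2_le x (r : R) : 0 <= r -> dot x x <= r ^+ 2 -> norm2 x <= r.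
Proof. by move=> r0; rewrite -sqr_norm2 ler_sqr // nnegrE norm2_ge0. Qed.

Lemma dot_le_norm2 x y : dot x y <= norm2 x * norm2 y.
Proof.
apply: le_trans (ler_norm _) _.
rewrite -ler_sqr ?nnegrE ?mulr_ge0 ?norm2_ge0 // real_normK ?num_real //.
rewrite exprMn !sqr_norm2 !dotE; apply: le_trans (cauchy_schwarz_sum _ _) _.
by under eq_bigr do rewrite expr2; under [X in _ * X <= _]eq_bigr do rewrite expr2.
Qed.

Lemma dot_comb z x y (s t : R) :
  dot z (fun i => s * x i + t * y i) = s * dot z x + t * dot z y.
Proof.
rewrite !dotE !mulr_sumr -big_split /=.
by apply: eq_bigr => i _; ring.
Qed.

Lemma dot_vsub z x y : dot z (vsub x y) = dot z x - dot z y.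
Proof.
rewrite !dotE -sumrB; apply: eq_bigr => i _.
by rewrite -mulrBr.
Qed.

Lemma norm2_comb x y (s t : R) : 0 <= s -> 0 <= t ->
  norm2 (fun i => s * x i + t * y i) <= s * norm2 x + t * norm2 y.
Proof.
move=> s0 t0; set w := fun i => _.
have nx := norm2_ge0 x; have ny := norm2_ge0 y.
apply: norm2_le; first by rewrite addr_ge0 ?mulr_ge0.
rewrite {2}/w dot_comb dotC (dotC w) /w !dot_comb (dotC y x) -!sqr_norm2.
by have := dot_le_norm2 x y; have := mulr_ge0 s0 t0; nra.
Qed.

Lemma norm2_vsub x y : norm2 x <= norm2 y + norm2 (vsub x y).
Proof.
have nx := norm2_ge0 x; have ny := norm2_ge0 y; have nxy := norm2_ge0 (vsub x y).
apply: norm2_le; first by rewrite addr_ge0.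
have := dot_le_norm2 y (vsub x y).
have := sqr_norm2 (vsub x y); rewrite dot_vsub (dotC _ x) (dotC _ y) !dot_vsub.
rewrite (dotC y x) -!sqr_norm2; nra.
Qed.

Lemma norm2_vsubC x y : norm2 (vsub x y) = norm2 (vsub y x).
Proof.
congr (sqrt _); rewrite !dotE; apply: eq_bigr => i _.
by rewrite (vsubE x y) (vsubE y x) -(opprB (x i)) mulrNN.
Qed.

End Euclidean.

(** * Convex pieces and the first-order oracle of their maximum *)

Section Pieces.
Variable d : nat.

(** Queries may leave the unit ball; [NormPiece] makes the function large far away, so that only
    queries of norm at most 2 need care. *)
Inductive piece := Affine of vec d & R | NormPiece.

Definition pval (p : piece) (x : vec d) : R :=
  match p with Affine g beta => dot g x + beta | NormPiece => (norm2 x - 1) / 2 end.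

(* At the origin the second branch is the zero vector, because [0^-1 = 0]. *)
Definition pgrad (p : piece) (x : vec d) : vec d :=
  match p with Affine g _ => g | NormPiece => fun i => (2 * norm2 x)^-1 * x i end.

Definition short_piece (p : piece) : Prop :=
  match p with Affine g _ => dot g g <= 1 | NormPiece => True end.

Lemma pval_convex p x y (t : R) : 0 <= t <= 1 ->
  pval p (fun i => t * x i + (1 - t) * y i) <= t * pval p x + (1 - t) * pval p y.
Proof.
move=> /andP[t0 t1]; case: p => [g beta|] /=; first by rewrite (dot_comb g x y); lra.
have := @norm2_comb _ x y t (1 - t) t0; rewrite subr_ge0 => /(_ t1).
by move: (norm2 (fun i => _)) => N; nra.
Qed.

Lemma pval_lipschitz p x y : short_piece p ->
  pval p x - pval p y <= norm2 (vsub x y).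
Proof.
case: p => [g beta|] /= => [g1|_].
  have -> : dot g x + beta - (dot g y + beta) = dot g (vsub x y).
    by rewrite dot_vsub; ring.
  apply: le_trans (dot_le_norm2 _ _) _; rewrite -[leRHS]mul1r.
  by apply: ler_wpM2r; [exact: norm2_ge0 | apply: norm2_le; rewrite ?expr1n].
by have := norm2_vsub x y; have := norm2_ge0 (vsub x y); lra.
Qed.

Lemma pgrad_subgradient p x y :
  pval p x + dot (pgrad p x) (vsub y x) <= pval p y.
Proof.
case: p => [g beta|] /=; first by rewrite dot_vsub; lra.
have -> : dot (fun i => (2 * norm2 x)^-1 * x i) (vsub y x) =
          (2 * norm2 x)^-1 * dot x (vsub y x).
  by rewrite !dotE mulr_sumr; apply: eq_bigr => i _; rewrite mulrA.
rewrite dot_vsub -sqr_norm2; have := dot_le_norm2 x y.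
have := norm2_ge0 x; have := norm2_ge0 y.
move: (norm2 x) (norm2 y) (dot x y) => X Y D Y0 X0 DXY.
have [->|X0'] := eqVneq X 0; first by rewrite mulr0 invr0; lra.
have Xp : 0 < X by rewrite lt_def X0'.
rewrite -subr_ge0.
(* The gap in the subgradient inequality is the Cauchy-Schwarz defect. *)
have -> : (Y - 1) / 2 - ((X - 1) / 2 + (2 * X)^-1 * (D - X ^+ 2)) =
   (X * Y - D) * (2 * X)^-1 by field.
by rewrite mulr_ge0 ?invr_ge0 ?subr_ge0 //; lra.
Qed.

Definition upd x (p q : piece) := if pval p x < pval q x then q else p.

(* The first maximiser in the list: appending a piece that does not exceed the
   maximum at [x] changes neither the value nor the subgradient at [x]. *)
Definition best (s : seq piece) x := foldl (upd x) NormPiece s.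

Definition maxp s x := pval (best s x) x.

Definition oracle s x := (maxp s x, pgrad (best s x) x).

Lemma best_rcons s q x : best (rcons s q) x = upd x (best s x) q.
Proof. by rewrite /best foldl_rcons. Qed.

Lemma oracle_rcons s q x : pval q x <= maxp s x -> oracle (rcons s q) x = oracle s x.
Proof.
by rewrite /oracle /maxp best_rcons /upd leNgt => /negbTE ->.
Qed.

Lemma maxp_rcons s q x : maxp (rcons s q) x = Num.max (maxp s x) (pval q x).
Proof.
by rewrite /maxp best_rcons /upd; case: ltP.
Qed.

Lemma maxp_ge s i x : pval (nth NormPiece s i) x <= maxp s x.
Proof.
elim/last_ind: s i => [|s q IH] i; first by rewrite nth_nil.
rewrite maxp_rcons le_max nth_rcons; case: ltnP => [_|]; first by rewrite IH.
case: eqP => [_|_] _; first by rewrite lexx orbT.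
by have := IH (size s); rewrite nth_default // => ->.
Qed.

(** The index [size s] stands for the initial [NormPiece], which is also the default of [nth]. *)
Lemma best_nth s x : exists2 i, (i <= size s)%N & best s x = nth NormPiece s i.
Proof.
elim/last_ind: s => [|s q [i ile bE]]; first by exists 0%N.
rewrite best_rcons /upd; case: ifP => _.
  exists (size s); first by rewrite size_rcons leqW.
  by rewrite nth_rcons ltnn eqxx.
rewrite bE; have [ilt|ige] := ltnP i (size s).
  by exists i; rewrite ?size_rcons ?leqW // nth_rcons ilt.
exists (size s).+1; first by rewrite size_rcons.
by rewrite !nth_default ?size_rcons.
Qed.

Section Valid.
Variable s : seq piece.
Hypothesis short_s : forall i, short_piece (nth NormPiece s i).

Lemma maxp_convex : convex_fun (maxp s).
Proof.
move=> x y t [/RleP t0 /RleP t1]; apply/RleP.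
set w := (fun i => _); have [i _ bE] := best_nth s w.
rewrite /maxp bE.
apply: le_trans (pval_convex _ _ _ _) _; first by apply/andP.
apply: lerD; apply: ler_wpM2l; rewrite ?subr_ge0 //; exact: maxp_ge.
Qed.

Lemma maxp_lipschitz : lipschitz1 (maxp s).
Proof.
have half x y : maxp s x - maxp s y <= norm2 (vsub x y).
  have [i _ bE] := best_nth s x; rewrite {1}/maxp bE.
  have := maxp_ge s i y; have := pval_lipschitz x y (short_s i); lra.
move=> x y; apply/RleP; rewrite -[Rabs _]/(`|maxp s x - maxp s y|).
by rewrite ler_norml half andbT; have := half y x; rewrite norm2_vsubC; lra.
Qed.

Lemma maxp_oracle : first_order_oracle (maxp s) (oracle s).
Proof.
move=> x; split=> // y; apply: Rle_ge; apply/RleP => /=.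
have [i _ bE] := best_nth s x; rewrite /maxp bE.
exact: le_trans (pgrad_subgradient _ _ _) (maxp_ge _ _ _).
Qed.

End Valid.
End Pieces.

(** * Orthogonal directions, splitting of coordinates, and rounding *)

Lemma unit_orthogonal b (I : finType) (e : I -> vec b) : (#|I| < b)%N ->
  exists2 w : vec b, dot w w = 1 & forall i, dot w (e i) = 0.
Proof.
move=> Ib; pose A : 'M[R]_(b, #|I|) := \matrix_(c, j) e (enum_val j) c.
(* [A] has fewer columns than rows, so its left kernel is nonzero. *)
have : kermx A != 0.
  by rewrite -mxrank_eq0 mxrank_ker subn_eq0 -ltnNge (leq_ltn_trans (rank_leq_col A)).
case/rowV0Pn => v /sub_kermxP vA v0.
pose v' : vec b := fun c => v 0 c.
have ve i : dot v' (e i) = 0.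
  move/rowP/(_ (enum_rank i)): vA; rewrite !mxE => h; rewrite -[RHS]h dotE.
  by apply: eq_bigr => c _; rewrite mxE enum_rankK.
have vv : 0 < dot v' v'.
  rewrite lt_def dot_ge0 andbT; apply: contraNneq v0 => h; apply/eqP/rowP => c.
  move/eqP: h; rewrite dotE psumr_eq0 => [/allP/(_ c)|? _]; last by rewrite -expr2 sqr_ge0.
  by rewrite mem_index_enum => /(_ isT); rewrite mulf_eq0 orbb mxE => /eqP.
pose s := norm2 v'.
have s0 : 0 < s by rewrite lt_def norm2_ge0 -sqrf_eq0 sqr_norm2 gt_eqF.
exists (fun c => s^-1 * v' c).
  transitivity (s^-1 ^+ 2 * dot v' v').
    by rewrite !dotE mulr_sumr; apply: eq_bigr => c _; ring.
  by rewrite -sqr_norm2 -/s -exprMn mulVf ?expr1n // gt_eqF.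
move=> i; transitivity (s^-1 * dot v' (e i)); last by rewrite ve mulr0.
by rewrite !dotE mulr_sumr; apply: eq_bigr => c _; rewrite mulrA.
Qed.

Lemma dot_dist_le b (v w u : vec b) (r B : R) : 0 <= B ->
  (forall c, `|v c - w c| <= r) -> (forall c, `|u c| <= B) ->
  `|dot v u - dot w u| <= b%:R * (r * B).
Proof.
move=> B0 vw uB; rewrite !dotE -sumrB.
apply: le_trans (ler_norm_sum _ _ _) _.
rewrite mulr_natl -[X in _ *+ X]card_ord -sumr_const; apply: ler_sum => c _.
by rewrite -mulrBl normrM ler_pM.
Qed.

Lemma abs_coord_le d (x : vec d) i : `|x i| <= norm2 x.
Proof.
rewrite -ler_sqr ?nnegrE ?norm2_ge0 // sqr_norm2 real_normK ?num_real //.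
rewrite dotE (bigD1 i) //= -expr2 lerDl.
by apply: sumr_ge0 => j _; rewrite -expr2 sqr_ge0.
Qed.

Definition vcat b n (u : vec b) (z : vec n) : vec (b + n) :=
  fun j => match split j with inl c => u c | inr i => z i end.
Definition lo b n (x : vec (b + n)) : vec b := fun c => x (lshift n c).
Definition hi b n (x : vec (b + n)) : vec n := fun i => x (rshift b i).

Lemma lo_vcat b n (u : vec b) (z : vec n) c : lo (vcat u z) c = u c.
Proof. by rewrite /lo /vcat (unsplitK (inl c)). Qed.

Lemma hi_vcat b n (u : vec b) (z : vec n) i : hi (vcat u z) i = z i.
Proof. by rewrite /hi /vcat (unsplitK (inr i)). Qed.

Lemma dot_split b n (x y : vec (b + n)) : dot x y = dot (lo x) (lo y) + dot (hi x) (hi y).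
Proof. by rewrite !dotE big_split_ord. Qed.

Lemma dot_vcat b n (u : vec b) (z : vec n) (x : vec (b + n)) :
  dot (vcat u z) x = dot u (lo x) + dot z (hi x).
Proof.
rewrite dot_split !dotE; congr (_ + _); apply: eq_bigr => i _; congr (_ * _).
  exact: lo_vcat.
exact: hi_vcat.
Qed.

Lemma norm2_lo_le b n (x : vec (b + n)) : norm2 (lo x) <= norm2 x.
Proof.
apply: norm2_le; first exact: norm2_ge0.
by rewrite sqr_norm2 dot_split lerDl dot_ge0.
Qed.

(* Vectors of the grid [-1, 1]^b of step [1 / G]: the directions are rounded to
   it so that a list of them can be counted. *)
Definition gvec b G := {ffun 'I_b -> 'I_(2 * G).+1}.
Definition gval b G (g : gvec b G) : vec b := fun c => (g c)%:R / G%:R - 1.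

Lemma gval_near b G (w : vec b) : (0 < G)%N -> (forall c, `|w c| <= 1) ->
  exists g : gvec b G, forall c, `|gval g c - w c| <= G%:R^-1.
Proof.
move=> G0 w1; have Gp : 0 < G%:R :> R by rewrite ltr0n.
exists [ffun c => inord (Num.truncn ((w c + 1) * G%:R))] => c.
rewrite /gval ffunE.
have /andP[wl wu] : -1 <= w c <= 1 by rewrite -ler_norml.
have y0 : 0 <= (w c + 1) * G%:R by rewrite mulr_ge0 //; lra.
have := truncn_itv y0; set m := Num.truncn _ => /andP[m1 m2].
rewrite inordK; last first.
  rewrite ltnS -(ler_nat R); apply: le_trans m1 _; rewrite natrM.
  by apply: ler_wpM2r => //; lra.
have -> : m%:R / G%:R - 1 - w c = (m%:R - (w c + 1) * G%:R) / G%:R.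
  by field; rewrite gt_eqF.
rewrite normrM [X in _ * X]gtr0_norm ?invr_gt0 // -[leRHS]mul1r.
apply: ler_wpM2r; first by rewrite invr_ge0.
by rewrite ler_norml; apply/andP; split; move: m2; rewrite -natr1; lra.
Qed.

Lemma gval_abs b G (g : gvec b G) c : (0 < G)%N -> `|gval g c| <= 1.
Proof.
move=> G0; have Gp : 0 < G%:R :> R by rewrite ltr0n.
have h : (g c)%:R <= 2 * G%:R :> R by rewrite -natrM ler_nat -ltnS.
rewrite ler_norml /gval; apply/andP; split.
  by rewrite lerBrDr addNr divr_ge0.
by rewrite lerBlDr ler_pdivrMr.
Qed.

(** * The pieces of the hard function *)

Section Construction.
Variables (b n G : nat) (lam mu gam : R).

Definition smat := {ffun 'I_n -> {ffun 'I_b -> bool}}.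
Definition svec (a : {ffun 'I_b -> bool}) : vec b := fun c => sgb R (a c).

Definition row_piece (i : 'I_n) (a : {ffun 'I_b -> bool}) (s : bool) : piece (b + n) :=
  Affine (vcat (fun c => sgb R s * lam * svec a c)
               (fun i' => if i' == i then sgb R s / 2 else 0)) (- mu).

Definition row_pieces (Am : smat) : seq (piece (b + n)) :=
  [seq row_piece p.1 (Am p.1) p.2 | p : 'I_n * bool].

(** The offset [l * gam] keeps a new direction below the values already seen at queries almost
    orthogonal to it. *)
Definition dir_piece (g : gvec b G) (l : nat) : piece (b + n) :=
  Affine (vcat (fun c => mu * gval g c) (fun=> 0)) (- (mu * (l%:R * gam))).

Definition dir_pieces (vs : seq (gvec b G)) : seq (piece (b + n)) :=
  mkseq (fun l => dir_piece (nth [ffun=> ord0] vs l) l) (size vs).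

Definition pieces (Am : smat) vs := row_pieces Am ++ dir_pieces vs.

Definition row_form (Am : smat) (x : vec (b + n)) i : R :=
  lam * dot (svec (Am i)) (lo x) + hi x i / 2.

Lemma pval_row_piece i a s x :
  pval (row_piece i a s) x = sgb R s * (lam * dot (svec a) (lo x) + hi x i / 2) - mu.
Proof.
rewrite /= dot_vcat; congr (_ - _); rewrite mulrDr; congr (_ + _).
  by rewrite !dotE !mulr_sumr; apply: eq_bigr => c _; rewrite !mulrA.
rewrite dotE (bigD1 i) //= eqxx big1 ?addr0 => [|j /negbTE ->]; last by rewrite mul0r.
by rewrite mulrA mulrAC.
Qed.

Lemma pval_dir_piece g l x :
  pval (dir_piece g l) x = mu * (dot (gval g) (lo x) - l%:R * gam).
Proof.
rewrite /= dot_vcat mulrBr; congr (_ - _).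
rewrite [X in _ + X]dotE big1 ?addr0 => [|i _]; last by rewrite mul0r.
by rewrite !dotE mulr_sumr; apply: eq_bigr => c _; rewrite mulrA.
Qed.

Lemma pieces_rcons Am vs g :
  pieces Am (rcons vs g) = rcons (pieces Am vs) (dir_piece g (size vs)).
Proof.
rewrite /pieces /dir_pieces size_rcons mkseqS -rcons_cat; congr (rcons (_ ++ _) _).
  by apply/eq_in_map => l; rewrite mem_iota nth_rcons => /andP[_ ->].
by rewrite nth_rcons ltnn eqxx.
Qed.

Lemma size_pieces Am vs : size (pieces Am vs) = (n * 2 + size vs)%N.
Proof.
by rewrite size_cat size_mkseq size_image card_prod card_ord card_bool.
Qed.

Lemma nth_piecesP Am vs i :
  [\/ nth (NormPiece (b + n)) (pieces Am vs) i = NormPiece (b + n),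
      exists r s, nth (NormPiece (b + n)) (pieces Am vs) i = row_piece r (Am r) s
    | exists2 l, (l < size vs)%N &
        nth (NormPiece (b + n)) (pieces Am vs) i = dir_piece (nth [ffun=> ord0] vs l) l].
Proof.
rewrite nth_cat; case: ltnP => [ilt|ige].
  apply: Or32; move: ilt; rewrite size_image => ilt.
  have /card_gt0P[p0 _] := leq_ltn_trans (leq0n i) ilt.
  exists (nth p0 (enum {: 'I_n * bool}) i).1, (nth p0 (enum {: 'I_n * bool}) i).2.
  by rewrite (nth_map p0) // -cardE.
case: (ltnP (i - size (row_pieces Am)) (size vs)) => [lt|ge].
  by apply: Or33; exists (i - size (row_pieces Am))%N; rewrite // nth_mkseq.
by apply: Or31; rewrite nth_default // size_mkseq.
Qed.

Lemma row_form_le Am vs x i : `|row_form Am x i| <= maxp (pieces Am vs) x + mu.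
Proof.
have h s : pval (row_piece i (Am i) s) x <= maxp (pieces Am vs) x.
  have : row_piece i (Am i) s = nth (NormPiece (b + n)) (pieces Am vs)
     (enum_rank (i, s)).
    rewrite nth_cat size_image ltn_ord (nth_map (i, s)) -?cardE ?ltn_ord //.
    by rewrite nth_enum_rank.
  by move=> ->; apply: maxp_ge.
have := h true; have := h false; rewrite !pval_row_piece -/(row_form Am x i) /sgb.
by move=> h1 h2; rewrite ler_norml; apply/andP; split; lra.
Qed.

Lemma maxp_ge_norm Am vs x : (norm2 x - 1) / 2 <= maxp (pieces Am vs) x.
Proof.
have := maxp_ge (pieces Am vs) (size (pieces Am vs)) x.
by rewrite nth_default.
Qed.

Lemma maxp_ge_dir Am vs x l : (l < size vs)%N ->
  mu * (dot (gval (nth [ffun=> ord0] vs l)) (lo x) - l%:R * gam) <= maxp (pieces Am vs) x.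
Proof.
move=> lt; have := maxp_ge (pieces Am vs) (size (row_pieces Am) + l) x.
by rewrite nth_cat ltnNge leq_addr addKn nth_mkseq // pval_dir_piece.
Qed.

End Construction.

(** * The adaptive construction *)

(** The principle of a resisting oracle: changing the function away from the queries already made,
    keeping their answers, leaves the run unchanged. *)
Lemma memory_agree d M (A : alg d M) (Q Q' : vec d -> R * vec d) t :
  (forall s, (s < t)%N -> Q' (psi_query A (memory A Q s)) = Q (psi_query A (memory A Q s))) ->
  forall s, (s <= t)%N -> memory A Q' s = memory A Q s.
Proof.
move=> agree; elim=> [//|s IH] st /=.
by rewrite IH 1?ltnW // agree.
Qed.

Section Adversary.
Variables (b n G K M : nat) (lam mu gam rho tau theta : R) (A : alg (b + n) M) (Am : smat b n).

Hypothesis tauE : tau = gam / 8.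
Hypothesis thetaE : theta = b%:R * (G%:R^-1 * 2).
Hypothesis b_gt0 : (0 < b)%N.
Hypothesis G_gt0 : (0 < G)%N.
Hypothesis Kb : (2 * K + 2 <= b)%N.
Hypothesis lam_small : 4 * lam ^+ 2 * b%:R * (b + n)%:R <= 1.
Hypothesis mu_small : 0 < mu <= 1 / 8.
Hypothesis gam_gt0 : 0 < gam.
Hypothesis rho_bounds : 0 < rho <= 1.
Hypothesis rho_small : 16 * rho ^+ 2 * b%:R <= 1.
Hypothesis gam_small : 4 * b%:R * gam <= rho.
Hypothesis theta_tau : theta <= tau.
Hypothesis theta_small : 16 * b%:R * theta <= 1.

Local Notation gvec := (gvec b G).
Local Notation g0 := ([ffun=> ord0] : gvec).
Local Notation pcs vs := (pieces lam mu gam Am vs).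

Definition query (vs : seq gvec) t := psi_query A (memory A (oracle (pcs vs)) t).

Definition orth (vs : seq gvec) (E : seq nat) (w : vec b) :=
  forall e, e \in E -> dot w (lo (query vs e)) = 0.

(** Dual form of the distance to a span: testing against unit vectors orthogonal to the exploring
    queries avoids projections. *)
Definition near (vs : seq gvec) E (x : vec (b + n)) :=
  forall w, orth vs E w -> dot w w <= 1 -> dot w (lo x) <= tau.

(* The answer at a settled point is unaffected by all directions chosen later. *)
Definition settled (vs : seq gvec) E x :=
  2 * mu * norm2 x <= maxp (pcs vs) x \/
  [/\ norm2 x <= 2, near vs E x &
      - mu * ((size E)%:R * gam + 2 * tau) <= maxp (pcs vs) x].

Definition spread (vs : seq gvec) :=
  (forall l, (l < size vs)%N -> `|dot (gval (nth g0 vs l)) (gval (nth g0 vs l)) - 1| <= theta) /\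
  (forall l l', (l < l' < size vs)%N -> `|dot (gval (nth g0 vs l)) (gval (nth g0 vs l'))| <= theta).

(* [w] certifies that the [j]-th exploring query is at distance at least [tau]
   from the span of the earlier ones (in the first [b] coordinates). *)
Definition exploring (vs : seq gvec) (E : seq nat) j :=
  let x := query vs (nth 0%N E j) in
  [/\ forall i, `|row_form lam Am x i| <= 5 * mu, norm2 x <= 2 &
      exists w, [/\ dot w w <= 1,
        forall i, (i < j)%N -> dot w (lo (query vs (nth 0%N E i))) = 0 &
        tau <= dot w (lo x)]].

(* [E] lists the exploring times before [t].  The last direction is, up to
   rounding, orthogonal to all exploring queries; this keeps the value at every
   query near their span above the level of the directions still to come. *)
Record invariant t (vs : seq gvec) (E : seq nat) : Prop := Invariant {
  inv_size : size vs = (size E).+1;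
  inv_spread : spread vs;
  inv_sorted : sorted ltn E;
  inv_time : forall e, e \in E -> (e < t)%N;
  inv_exploring : forall j, (j < size E)%N -> exploring vs E j;
  inv_last : exists w, [/\ orth vs E w, dot w w <= 1 &
               forall c, `|gval (last g0 vs) c - w c| <= G%:R^-1];
  inv_settled : forall s, (s < t)%N -> settled vs E (query vs s) }.

Let muP : 0 < mu. Proof. by case/andP: mu_small. Qed.
Let tauP : 0 < tau. Proof. by rewrite tauE divr_gt0. Qed.
Let theta_ge0 : 0 <= theta.
Proof. by rewrite thetaE mulr_ge0 // mulr_ge0 // invr_ge0. Qed.
Let bR1 : 1 <= b%:R :> R. Proof. by rewrite ler1n. Qed.
Let theta16 : 16 * theta <= 1.
Proof. apply: le_trans theta_small; rewrite mulrAC -[leLHS]mulr1; apply: ler_wpM2l => //; have := theta_ge0; lra. Qed.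

Lemma dot_gval_near g (w u : vec b) (B : R) : 0 <= B ->
  (forall c, `|gval (g : gvec) c - w c| <= G%:R^-1) -> (forall c, `|u c| <= B) ->
  `|dot (gval g) u - dot w u| <= theta / 2 * B.
Proof.
move=> B0 gw uB; apply: le_trans (dot_dist_le B0 gw uB) _.
by rewrite thetaE le_eqVlt; apply/orP; left; apply/eqP; field; rewrite pnatr_eq0 -lt0n.
Qed.

(** The two factors are rounded one at a time, each at cost [theta / 2]. *)
Lemma gval_sqr_near g (w : vec b) : dot w w = 1 ->
  (forall c, `|gval (g : gvec) c - w c| <= G%:R^-1) ->
  `|dot (gval g) (gval g) - 1| <= theta.
Proof.
move=> w1 gw.
have wc c : `|w c| <= 1.
  by apply: le_trans (abs_coord_le w c) _; apply: norm2_le; rewrite ?w1 ?expr1n.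
have h1 := dot_gval_near ler01 gw (fun c => gval_abs g c G_gt0).
have h2 := dot_gval_near ler01 gw wc.
move: h1 h2; rewrite (dotC w (gval g)) w1 !ler_norml => /andP[? ?] /andP[? ?].
by apply/andP; split; lra.
Qed.

Lemma lo_le2 (x : vec (b + n)) c : norm2 x <= 2 -> `|lo x c| <= 2.
Proof. by apply: le_trans; apply: (abs_coord_le x). Qed.

Lemma near_abs vs E x w : near vs E x -> orth vs E w -> dot w w <= 1 ->
  `|dot w (lo x)| <= tau.
Proof.
move=> nr ow w1; rewrite ler_norml nr // andbT.
pose w' : vec b := fun c => - w c.
have w'E u : dot w' u = - dot w u.
  by rewrite !dotE -sumrN; apply: eq_bigr => c _; rewrite mulNr.
have := nr w'; rewrite (w'E (lo x)) => h; rewrite lerNl; apply: h.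
  by move=> e eE; rewrite w'E ow ?oppr0.
by rewrite w'E dotC w'E opprK.
Qed.

(** This explains the threshold in [settled]: at a point whose value reaches [2 * mu * norm2 x], no
    later direction can take over. *)
Lemma dir_piece_le g l x : dot (gval (g : gvec)) (gval g) <= 4 ->
  pval (dir_piece n mu gam g l) x <= 2 * mu * norm2 x.
Proof.
move=> g4; rewrite pval_dir_piece.
have ng : norm2 (gval g) <= 2 by apply: norm2_le => //; apply: le_trans g4 _; lra.
have h : dot (gval g) (lo x) <= 2 * norm2 x.
  apply: le_trans (dot_le_norm2 _ _) _.
  by apply: ler_pM; rewrite ?norm2_ge0 ?norm2_lo_le.
have l0 : 0 <= l%:R * gam by rewrite mulr_ge0 // ltW.
rewrite -mulrA mulrCA; apply: ler_wpM2l; first exact: ltW.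
by lra.
Qed.

(** The norm piece forces [norm2 x <= 2], so the value is below [4 * mu]; the shift [mu] of the row
    pieces makes this [5 * mu]. *)
Lemma unsafe_bounds (vs : seq gvec) x : maxp (pcs vs) x < 2 * mu * norm2 x ->
  norm2 x <= 2 /\ forall i, `|row_form lam Am x i| <= 5 * mu.
Proof.
move=> uns; have n0 := norm2_ge0 x; have := maxp_ge_norm lam mu gam Am vs x => h.
case/andP: mu_small => m0 m1.
have x2 : norm2 x <= 2 by nra.
split=> // i; apply: le_trans (row_form_le lam mu gam Am vs x i) _.
nra.
Qed.

Lemma invariant0 : exists vs, invariant 0 vs [::].
Proof.
have [|w w1 _] := @unit_orthogonal b void (fun=> (fun=> 0)).
  by rewrite card_void.
have wc c : `|w c| <= 1.
  by apply: le_trans (abs_coord_le w c) _; apply: norm2_le; rewrite ?w1 ?expr1n.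
have [g gw] := gval_near G_gt0 wc; exists [:: g].
split=> //; last by exists w; rewrite w1; split.
split=> [[|l] // _|l [|l']] /=; rewrite ?ltnS ?ltn0 ?andbF //.
exact: gval_sqr_near gw.
Qed.

(** In the near case the inner product with the new direction is at most [tau + theta], and one
    further drop [gam] pays for it since [3 * tau + theta <= gam]. *)
Lemma settled_new (vs : seq gvec) E w (g : gvec) x :
  orth vs E w -> dot w w = 1 -> (forall c, `|gval g c - w c| <= G%:R^-1) ->
  settled vs E x ->
  pval (dir_piece n mu gam g (size E).+1) x <= maxp (pcs vs) x.
Proof.
move=> ow w1 gw [safe|[x2 nr low]].
  apply: le_trans safe; apply: dir_piece_le.
  by have := gval_sqr_near w1 gw; rewrite ler_norml => /andP[_]; have := theta16; lra.
apply: le_trans low; rewrite pval_dir_piece mulNr -mulrN; apply: ler_wpM2l; first exact: ltW.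
have h := dot_gval_near (ler0n R 2) gw (fun c => lo_le2 c x2).
have := near_abs nr ow; rewrite w1 => /(_ (lexx _)).
move: h; rewrite !ler_norml -(natr1 (size E)) => /andP[_ h1] /andP[_ h2].
by have := theta_tau; have := tauE; have := gam_gt0; lra.
Qed.

Lemma invariant_step t vs E : invariant t vs E -> (size E < K)%N ->
  exists vs' E', invariant t.+1 vs' E' /\ (size E' <= (size E).+1)%N.
Proof.
move=> [szv sp srt tm ex [wl [owl wl1 wlc]] st] szE.
set x := query vs t.
have keep : settled vs E x -> invariant t.+1 vs E.
  move=> sx; split=> //; [by move=> e /tm/ltnW | by exists wl |].
  by move=> s; rewrite ltnS leq_eqVlt => /orP[/eqP->|/st].
have [safe|uns] := lerP (2 * mu * norm2 x) (maxp (pcs vs) x).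
  by exists vs, E; split=> //; apply: keep; left.
have [x2 rows] := unsafe_bounds uns.
(* Near the span, the last direction, of index [size E], is almost orthogonal to the query and
   bounds the value from below; otherwise time [t] is exploring. *)
have [nr|nnr] := boolp.pselect (near vs E x).
  exists vs, E; split=> //; apply: keep; right; split=> //.
  have lt : (size E < size vs)%N by rewrite szv.
  apply: le_trans (maxp_ge_dir lam mu gam Am x lt).
  rewrite mulNr -mulrN; apply: ler_wpM2l; first exact: ltW.
  have := dot_gval_near (ler0n R 2) wlc (fun c => lo_le2 c x2).
  have := near_abs nr owl wl1.
  rewrite (last_nth g0) szv /= !ler_norml => /andP[h1 _] /andP[h2 _].
  have -> : nth g0 vs (size E) = nth g0 (g0 :: vs) (size E).+1 by [].
  by have := theta_tau; lra.
pose E' := rcons E t.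
pose ev (i : 'I_(size E') + 'I_(size vs)) : vec b :=
  match i with inl i => lo (query vs (nth 0%N E' i)) | inr i => gval (nth g0 vs i) end.
(* There are [2 * size E + 2] conditions, fewer than [b] by [Kb]. *)
have [|w w1 wev] := @unit_orthogonal b _ ev.
  rewrite card_sum [#|'I_(size E')|]card_ord [#|'I_(size vs)|]card_ord.
  by rewrite szv size_rcons; move: Kb szE; clear; lia.
have wE' : orth vs E' w.
  move=> e eE'; have ie : (index e E' < size E')%N by rewrite index_mem.
  by have := wev (inl (Ordinal ie)); rewrite /= nth_index.
have wvs l : (l < size vs)%N -> dot w (gval (nth g0 vs l)) = 0.
  by move=> lt; apply: (wev (inr (Ordinal lt))).
have wc c : `|w c| <= 1.
  by apply: le_trans (abs_coord_le w c) _; apply: norm2_le; rewrite ?w1 ?expr1n.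
have [g gw] := gval_near G_gt0 wc.
have oE e : e \in E -> e \in E' by rewrite mem_rcons inE => ->; rewrite orbT.
have wE : orth vs E w by move=> e /oE; apply: wE'.
pose vs' := rcons vs g.
have pE : pcs vs' = rcons (pcs vs) (dir_piece n mu gam g (size E).+1).
  by rewrite pieces_rcons szv.
have stable s : (s < t)%N -> oracle (pcs vs') (query vs s) = oracle (pcs vs) (query vs s).
  move=> lt; rewrite pE oracle_rcons //.
  exact: settled_new gw (st _ lt).
(* The case [s = t] is included, because the query at time [t] depends only on earlier answers. *)
have qE s : (s <= t)%N -> query vs' s = query vs s.
  by move=> le; rewrite /query (memory_agree stable le).
have grow y : maxp (pcs vs) y <= maxp (pcs vs') y.
  by rewrite pE maxp_rcons le_max lexx.
have orthE' v : orth vs' E' v -> orth vs E' v.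
  move=> ov e eE'; rewrite -qE; first exact: ov.
  by move: eE'; rewrite mem_rcons inE => /orP[/eqP->|/tm/ltnW].
have xE' : t \in E' by rewrite mem_rcons inE eqxx.
exists vs', E'; split; last by rewrite size_rcons.
have E'le j : (j < size E')%N -> (nth 0%N E' j <= t)%N.
  move=> lt; have := mem_nth 0%N lt; rewrite mem_rcons inE => /orP[/eqP->//|/tm/ltnW//].
have nthE j : (j < size E)%N -> nth 0%N E' j = nth 0%N E j.
  by move=> lt; rewrite nth_rcons lt.
split.
- by rewrite !size_rcons szv.
- case: sp => sp1 sp2; split=> [l|l l'].
    rewrite size_rcons ltnS leq_eqVlt => /orP[/eqP->|lt].
      by rewrite nth_rcons ltnn eqxx; apply: gval_sqr_near gw.
    by rewrite nth_rcons lt; apply: sp1.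
  rewrite size_rcons ltnS [(l' <= _)%N]leq_eqVlt => /andP[ll' /orP[/eqP l'E|lt]].
    rewrite l'E in ll' *; rewrite !nth_rcons ltnn eqxx ll' dotC.
    have := dot_gval_near ler01 gw (fun c => gval_abs (nth g0 vs l) c G_gt0).
    by rewrite wvs // subr0 => h; apply: le_trans h _; have := theta_ge0; lra.
  by rewrite !nth_rcons lt (ltn_trans ll' lt); apply: sp2; rewrite ll'.
- rewrite /E' -cats1; case: (E) srt tm => //= e E0 srt tm.
  rewrite cat_path /= andbT; apply/andP; split=> //.
  by apply: tm; rewrite mem_last.
- by move=> e; rewrite mem_rcons inE => /orP[/eqP->//|/tm/ltnW].
- move=> j; rewrite size_rcons ltnS leq_eqVlt => /orP[/eqP ->|lt]; last first.
    have [e1 e2 [v [v1 v2 v3]]] := ex j lt.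
    have le : (nth 0%N E j <= t)%N by rewrite ltnW // tm // mem_nth.
    rewrite /exploring nthE // qE //; split=> //; exists v; split=> // i ij.
    have iE := ltn_trans ij lt.
    by rewrite nthE // qE ?v2 // ltnW // tm // mem_nth.
  rewrite /exploring nth_rcons ltnn eqxx qE // -/x; split=> //.
  (* The failure of [near] is exactly a certificate for the new exploring query. *)
  move: nnr => /boolp.existsNP[v /boolp.not_implyP[ov /boolp.not_implyP[v1 /negP]]].
  rewrite -ltNge => v3; exists v; split=> //; last exact: ltW.
  move=> i iE; rewrite nthE // qE ?ov ?mem_nth //.
  by rewrite ltnW // tm // mem_nth.
- exists w; split=> //; last by move=> c; rewrite last_rcons.
    move=> e eE'; rewrite qE ?wE' //.
    by move: eE'; rewrite mem_rcons inE => /orP[/eqP->|/tm/ltnW].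
  by rewrite w1.
move=> s; rewrite ltnS leq_eqVlt => /orP[/eqP->|lt]; last first.
  rewrite qE; last exact: ltnW.
  case: (st s lt) => [safe|[s2 nr low]]; [left|right; split=> //].
  - by apply: le_trans safe _; apply: grow.
  - by move=> v /orthE' ov; apply: nr => e /oE; apply: ov.
  apply: le_trans (grow _); apply: le_trans low.
  rewrite !mulNr lerN2; apply: ler_wpM2l; first exact: ltW.
  by rewrite size_rcons -(natr1 (size E)); have := gam_gt0; lra.
(* The query at time [t] now belongs to [E']: it is trivially near, and the new direction,
   orthogonal to it up to rounding, bounds its value from below. *)
rewrite qE // -/x; right; split=> //.
  by move=> v /orthE' ov _; rewrite (ov t xE') ltW.
have lt : ((size E).+1 < size vs')%N by rewrite size_rcons szv.
apply: le_trans (maxp_ge_dir lam mu gam Am x lt).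
rewrite mulNr -mulrN; apply: ler_wpM2l; first exact: ltW.
have := dot_gval_near (ler0n R 2) gw (fun c => lo_le2 c x2).
rewrite (wE' t xE') subr0 ler_norml => /andP[h _].
rewrite nth_rcons szv ltnn eqxx size_rcons.
by have := theta_tau; have := theta_ge0; lra.
Qed.

(** The squared gradient norms are [lam ^ 2 * b + 1 / 4] for rows and at most [2 * mu ^ 2] for
    directions. *)
Lemma pieces_short (vs : seq gvec) : spread vs ->
  forall i, short_piece (nth (NormPiece (b + n)) (pcs vs) i).
Proof.
move=> [sp _] i.
case: (nth_piecesP lam mu gam Am vs i) => [->|[r [s ->]]|[l lt ->]] //=.
  rewrite dot_vcat.
  have -> : dot (fun c => sgb R s * lam * svec (Am r) c)
                (lo (vcat (fun c => sgb R s * lam * svec (Am r) c)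
                   (fun i' => if i' == r then sgb R s / 2 else 0))) = lam ^+ 2 * b%:R.
    rewrite dotE -mulr_natr -[in RHS](card_ord b) -sumr_const mulr_sumr.
    apply: eq_bigr => c _; rewrite lo_vcat -expr2 !exprMn !sqr_sgb.
    by rewrite mul1r.
  rewrite dotE (bigD1 r) //= hi_vcat eqxx big1 => [|j /negbTE jr]; last by rewrite jr mul0r.
  have -> : sgb R s / 2 * (sgb R s / 2) = sgb R s ^+ 2 / 4 by field.
  rewrite sqr_sgb; have := lam_small; have := bR1.
  rewrite natrD; have := ler0n R n; have := sqr_ge0 lam.
  move: (lam ^+ 2) (b%:R : R) (n%:R : R) => L B N L0 N0 B1 h.
  have : 4 * L * B * 1 <= 4 * L * B * (B + N).
    by apply: ler_wpM2l; [rewrite !mulr_ge0 //; lra | lra].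
  by lra.
rewrite dot_vcat [X in _ + X]dotE big1 ?addr0 => [|j _]; last by rewrite mul0r.
have -> : dot (fun c => mu * gval (nth g0 vs l) c)
              (lo (vcat (fun c => mu * gval (nth g0 vs l) c) (fun=> 0 : R) : vec (b + n))) =
          mu ^+ 2 * dot (gval (nth g0 vs l)) (gval (nth g0 vs l)).
  by rewrite !dotE mulr_sumr; apply: eq_bigr => c _; rewrite lo_vcat; ring.
have := sp l lt; rewrite ler_norml => /andP[_]; have := theta16.
case/andP: mu_small; move: (dot _ _) => D m0 m1 t16 Dt.
have D2 : D <= 2 by lra.
by have : mu ^+ 2 <= 1 / 64; nra.
Qed.

(* The slack coordinates [z] cancel all row forms exactly at this point. *)
Lemma low_point (vs : seq gvec) : spread vs -> (size vs <= b)%N ->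
  exists2 y : vec (b + n), norm2 y <= 1 & maxp (pcs vs) y <= - (3 / 4 * (mu * rho)).
Proof.
move=> [sp1 sp2] szb.
pose g (l : 'I_(size vs)) := gval (nth g0 vs l).
pose sv : vec b := fun c => \sum_l g l c.
have dot_sv w : dot w sv = \sum_l dot w (g l).
  rewrite dotE /sv; under eq_bigr do rewrite mulr_sumr.
  by rewrite exchange_big.
have bt : b%:R * theta <= 1 / 16 by have := theta_small; lra.
have gsv l : `|dot (g l) sv - 1| <= 1 / 8.
  rewrite dot_sv (bigD1 l) //= addrAC.
  have h1 := sp1 l (ltn_ord l).
  have h2 : `|\sum_(l' | l' != l) dot (g l) (g l')| <= b%:R * theta.
    apply: le_trans (ler_norm_sum _ _ _) _.
    apply: (@le_trans _ _ (\sum_(l' < size vs) theta)).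
      rewrite [leRHS](bigD1 l) //= -[leLHS]add0r; apply: lerD => //.
      apply: ler_sum => l' ll'; have := ll'; rewrite -val_eqE /= neq_ltn => /orP[lt|lt].
        by rewrite dotC; apply: sp2; rewrite lt ltn_ord.
      by apply: sp2; rewrite lt ltn_ord.
    rewrite sumr_const card_ord -[theta *+ _]mulr_natl; apply: ler_wpM2r => //.
    by rewrite ler_nat.
  apply: le_trans (ler_normD _ _) _; have := theta16; lra.
(* By [gsv], moving against the sum of the nearly orthonormal directions lowers all of them at once,
   by about [rho]. *)
pose u : vec b := fun c => - rho * sv c.
have dot_u w : dot w u = - rho * dot w sv.
  by rewrite !dotE mulr_sumr; apply: eq_bigr => c _; rewrite mulrCA.
pose z : vec n := fun i => - 2 * lam * dot (svec (Am i)) u.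
case/andP: rho_bounds => rho0 rho1; case/andP: mu_small => mu0 mu1.
have uu : dot u u <= 9 / 128.
  rewrite dot_u dotC dot_u mulrA mulrNN dot_sv.
  have : \sum_l dot sv (g l) <= b%:R * (9 / 8).
    apply: (@le_trans _ _ (\sum_(l < size vs) (9 / 8))).
      apply: ler_sum => l _; have := gsv l; rewrite ler_norml dotC => /andP[_]; lra.
    rewrite sumr_const card_ord -[(9 / 8) *+ _]mulr_natl; apply: ler_wpM2r => //; first by lra.
    by rewrite ler_nat.
  move: (\sum_l _) => S hS.
  apply: (@le_trans _ _ (rho * rho * (b%:R * (9 / 8)))).
    by apply: ler_wpM2l => //; rewrite mulr_ge0 ?ltW.
  by have := rho_small; rewrite expr2; lra.
have zz : dot z z <= dot u u.
  apply: (@le_trans _ _ (\sum_(i < n) (4 * lam ^+ 2 * b%:R * dot u u))).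
    rewrite dotE; apply: ler_sum => i _.
    have -> : z i * z i = 4 * lam ^+ 2 * (dot (svec (Am i)) u) ^+ 2 by rewrite /z; ring.
    rewrite -[leRHS]mulrA; apply: ler_wpM2l; first by rewrite mulr_ge0 ?sqr_ge0.
    rewrite dotE; apply: le_trans (cauchy_schwarz_sum _ _) _.
    have -> : \sum_c svec (Am i) c ^+ 2 = b%:R.
      by under eq_bigr do rewrite sqr_sgb; rewrite sumr_const card_ord.
    by rewrite dotE; under eq_bigr do rewrite expr2.
  rewrite sumr_const card_ord -[_ *+ n]mulr_natl mulrA -[leRHS]mul1r.
  apply: ler_wpM2r; first exact: dot_ge0.
  apply: le_trans lam_small; rewrite mulrC; apply: ler_wpM2l.
    by apply: mulr_ge0 => //; apply: mulr_ge0 => //; apply: sqr_ge0.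
  by rewrite ler_nat leq_addl.
pose y := vcat u z.
(* Radius 1/2 instead of 1 puts the norm piece at most at [- 1 / 4], below the required level. *)
have y12 : norm2 y <= 1 / 2.
  apply: norm2_le; first by lra.
  rewrite dot_split.
  have -> : dot (lo y) (lo y) = dot u u.
    by rewrite !dotE; apply: eq_bigr => c _; rewrite lo_vcat.
  have -> : dot (hi y) (hi y) = dot z z.
    by rewrite !dotE; apply: eq_bigr => c _; rewrite hi_vcat.
  by rewrite expr2; lra.
have mr : mu * rho <= mu by rewrite -[leRHS]mulr1; apply: ler_wpM2l => //; exact: ltW.
exists y; first by lra.
have loy w : dot w (lo y) = dot w u.
  by rewrite !dotE; apply: eq_bigr => c _; rewrite lo_vcat.
rewrite /maxp; have [i _ ->] := best_nth (pcs vs) y.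
case: (nth_piecesP lam mu gam Am vs i) => [->|[r [s ->]]|[l lt ->]].
- by rewrite /=; lra.
- rewrite pval_row_piece loy hi_vcat /z.
  have -> : lam * dot (svec (Am r)) u + - 2 * lam * dot (svec (Am r)) u / 2 = 0 by field.
  by rewrite mulr0; lra.
rewrite pval_dir_piece loy dot_u.
have := gsv (Ordinal lt); rewrite ler_norml /g /= => /andP[h _].
have lg : 0 <= l%:R * gam by rewrite mulr_ge0 // ltW.
have h2 : rho * (7 / 8) <= rho * dot (gval (nth g0 vs l)) sv.
  by apply: ler_wpM2l; [exact: ltW | lra].
have -> : - (3 / 4 * (mu * rho)) = mu * (- (3 / 4 * rho)) by ring.
by apply: ler_wpM2l; [exact: ltW | lra].
Qed.

(** With fewer than [K] exploring queries up to [T0], every value seen is at least [- mu * rho / 4],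
    which exceeds the value at [low_point] by [mu * rho / 2 > eps]. *)
Lemma adversary (eps : R) T0 : (0 < K)%N -> eps < mu * rho / 2 ->
  minimizes_all A eps ->
  (forall f O T, convex_fun f -> lipschitz1 f -> first_order_oracle f O ->
     stops_at A O T -> (T <= T0)%N) ->
  exists vs E t, [/\ (t <= T0)%N, invariant t vs E & size E = K].
Proof.
move=> K0 epslt minA stopA.
have run t : (exists vs E t', [/\ (t' <= t)%N, invariant t' vs E & size E = K]) \/
             (exists vs E, invariant t vs E /\ (size E < K)%N).
  elim: t => [|t [[vs [E [t' [t't i sz]]]]|[vs [E [i sz]]]]].
  - by have [vs i] := invariant0; right; exists vs, [::].
  - by left; exists vs, E, t'; split=> //; apply: leqW.
  have [vs' [E' [i' sz']]] := invariant_step i sz.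
  have := leq_trans sz' sz; rewrite leq_eqVlt => /orP[/eqP e|lt].
    by left; exists vs', E', t.+1.
  by right; exists vs', E'.
case: (run T0) => // -[vs [E [[szv sp _ _ _ _ st] szE]]].
have short := pieces_short sp.
have cf := maxp_convex (pcs vs); have lf := maxp_lipschitz short.
have fo := maxp_oracle (pcs vs).
have [T [sT [_ best]]] := minA _ _ cf lf fo.
have TT0 := stopA _ _ _ cf lf fo sT.
case: sT => T1 _.
have szb : (size vs <= b)%N by rewrite szv; move: Kb szE; clear; lia.
have [y y1 ylow] := low_point sp szb.
have {}y1 : in_unit_ball y by apply/RleP.
have {best}/RleP best : Rle (maxp (pcs vs) (query vs T.-1)) (maxp (pcs vs) y + eps).
  exact: best y y1.
(* The output is the query made from memory number [T.-1], so it is one of the settled queries. *)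
have /st : (T.-1 < T0)%N by move: T1 TT0; clear; case: T.
case/andP: rho_bounds => rho0 _.
have mr : 0 < mu * rho by rewrite mulr_gt0.
have low : - (mu * rho / 4) <= maxp (pcs vs) (query vs T.-1) ->
    False.
  move=> low; have : - (mu * rho / 4) <= - (3 / 4 * (mu * rho)) + eps.
    apply: le_trans low _; apply: le_trans best _.
    by apply: lerD.
  by lra.
case=> [safe|[_ _ h]]; exfalso; apply: low.
  apply: le_trans safe; have : 0 <= 2 * mu * norm2 (query vs T.-1).
    by rewrite !mulr_ge0 ?norm2_ge0 // ltW.
  by lra.
apply: le_trans h; rewrite mulNr lerN2 -mulrA; apply: ler_wpM2l; first exact: ltW.
have : (size E).+1%:R <= b%:R :> R by rewrite ler_nat -szv.
rewrite -(natr1 (size E)) => h.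
have : ((size E)%:R + 1) * gam <= b%:R * gam by apply: ler_wpM2r => //; exact: ltW.
by have := gam_small; have := tauE; have := gam_gt0; lra.
Qed.

End Adversary.

(** * Counting matrices by transcripts *)

Lemma nth_sorted_ltn (E : seq nat) i j :
  sorted ltn E -> (i < j < size E)%N -> (nth 0 E i < nth 0 E j)%N.
Proof.
move=> srt /andP[ij jE].
by apply: (sorted_ltn_nth ltn_trans) => //; rewrite inE // (ltn_trans ij).
Qed.

Lemma sorted_ltn_ge (E : seq nat) i j :
  sorted ltn E -> (i + j < size E)%N -> (nth 0 E i + j <= nth 0 E (i + j))%N.
Proof.
move=> srt; elim: j => [|j IH] lt; first by rewrite !addn0.
rewrite addnS; apply: leq_ltn_trans (IH _) _; first by move: lt; lia.
by apply: nth_sorted_ltn => //; rewrite addnS ltnS leqnn -addnS.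
Qed.

(** If all [p] blocks spanned at least [m] steps, the last entry of [E] would be at least
    [p * m >= T0]. *)
Lemma short_block (E : seq nat) p k m T0 :
  sorted ltn E -> size E = (p * k)%N -> (0 < p)%N -> (0 < k)%N ->
  (forall e, e \in E -> (e < T0)%N) -> (T0 <= p * m)%N ->
  exists2 j, (j < p)%N & (nth 0 E (j * k + k.-1) < nth 0 E (j * k) + m)%N.
Proof.
move=> srt szE p0 k0 ET T0p; apply: contrapT => none.
have long j : (j < p)%N -> (nth 0 E (j * k) + m <= nth 0 E (j * k + k.-1))%N.
  by move=> jp; rewrite leqNgt; apply/negP => h; apply: none; exists j.
have inE' j : (j < p)%N -> (j * k + k.-1 < size E)%N.
  by move=> jp; rewrite szE; move: k0 jp; clear; nia.
have start j : (j < p)%N -> (j * m <= nth 0 E (j * k))%N.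
  elim: j => [//|j IH] jp; have jp' := ltnW jp.
  rewrite mulSn addnC; apply: leq_trans (leq_trans (long j jp') _).
    by rewrite leq_add2r IH.
  apply/ltnW/nth_sorted_ltn => //; apply/andP; split.
    by move: k0; clear; nia.
  by apply: leq_ltn_trans (inE' _ jp); rewrite leq_addr.
have lst : (p.-1 < p)%N by rewrite prednK.
have := ET _ (mem_nth 0%N (inE' _ lst)).
apply/negP; rewrite -leqNgt; apply: leq_trans T0p _.
apply: leq_trans (long _ lst).
by rewrite -{1}(prednK p0) mulSn addnC leq_add2r start.
Qed.

(** Restarting from a stored memory state makes the history before a block irrelevant. *)
Fixpoint simulate d M (A : alg d M) (Q : vec d -> R * vec d) (mem : M.-tuple bool) r :=
  if r is r'.+1 then
    let mem' := simulate A Q mem r' in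
    psi_update A mem' (psi_query A mem') (Q (psi_query A mem'))
  else mem.

Lemma memory_simulate d M (A : alg d M) Q s r :
  memory A Q (s + r) = simulate A Q (memory A Q s) r.
Proof. by elim: r => [|r IH]; rewrite ?addn0 // addnS /= IH. Qed.

Section Counting.
Variables (b n G K M m k q : nat) (lam mu gam tau : R) (A : alg (b + n) M).
Hypothesis b_gt0 : (0 < b)%N.
Hypothesis mn : (m <= n)%N.
Hypothesis qk : (q <= k)%N.
Hypothesis qb : (q <= b)%N.
Hypothesis lam_gt0 : 0 < lam.
Hypothesis mu_gt0 : 0 < mu.
Hypothesis tau_gt0 : 0 < tau.
(** Half-width of the slab that a bound [5 * mu] on the row form imposes on a row, after division by
    [lam]. *)
Let eta := 5 * mu / lam.
Hypothesis eta1 : eta <= 1.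
Hypothesis slab_small : (4 * k%:R * b%:R) ^+ k * eta ^+ (2 * (k - q)) < tau ^+ (2 * k).

Local Notation gvec := (gvec b G).
Local Notation pcs Am vs := (pieces lam mu gam Am vs).

(* The memory at the start of a short block, the directions, the index of the
   piece returned at each step of the block, and the exploring steps: with the
   rows occurring among those pieces, this determines all queries of the block. *)
Definition transcript : finType :=
  (M.-tuple bool * K.+1.-tuple gvec *
   {ffun 'I_m -> 'I_(n * 2 + K.+1).+1} * {ffun 'I_k -> 'I_m})%type.

Definition visited (Am : smat b n) (mem : M.-tuple bool) (vs : seq gvec) r :=
  psi_query A (simulate A (oracle (pcs Am vs)) mem r).

Definition explains (Am : smat b n) (c : transcript) : Prop :=
  let: (mem, vs, resp, pos) := c in
  (forall r : 'I_m, best (pcs Am vs) (visited Am mem vs r) =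
                    nth (NormPiece (b + n)) (pcs Am vs) (resp r)) /\
  (forall j : 'I_k, let x := visited Am mem vs (pos j) in
     [/\ forall i, `|row_form lam Am x i| <= 5 * mu, norm2 x <= 2 &
      exists w, [/\ dot w w <= 1,
        forall i : 'I_k, (i < j)%N -> dot w (lo (visited Am mem vs (pos i))) = 0 &
        tau <= dot w (lo x)]]).

(** A piece involves at most one row. Past the row pieces, the hypothesis speaks of the row of the
    default [p0], so each step still accounts for one row only. *)
Lemma nth_pieces_agree (Am Am' : smat b n) (vs : seq gvec) (p0 : 'I_n * bool) i :
  Am (nth p0 (enum {: 'I_n * bool}) i).1 = Am' (nth p0 (enum {: 'I_n * bool}) i).1 ->
  nth (NormPiece (b + n)) (pcs Am vs) i = nth (NormPiece (b + n)) (pcs Am' vs) i.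
Proof.
move=> e; rewrite !nth_cat !size_image; case: ltnP => // ilt.
by rewrite !(nth_map p0) -?enumT -?cardE // e.
Qed.

(** Equal memories give equal queries, and the answer is a function of the query and the maximising
    piece. *)
Lemma visited_agree (Am Am' : smat b n) (vs : seq gvec) mem
    (resp : 'I_m -> nat) :
  (forall r : 'I_m, best (pcs Am vs) (visited Am mem vs r) =
                    nth (NormPiece (b + n)) (pcs Am vs) (resp r)) ->
  (forall r : 'I_m, best (pcs Am' vs) (visited Am' mem vs r) =
                    nth (NormPiece (b + n)) (pcs Am' vs) (resp r)) ->
  (forall r, nth (NormPiece (b + n)) (pcs Am vs) (resp r) =
             nth (NormPiece (b + n)) (pcs Am' vs) (resp r)) ->
  forall r, (r <= m)%N -> simulate A (oracle (pcs Am vs)) mem r =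
                          simulate A (oracle (pcs Am' vs)) mem r.
Proof.
move=> h h' e; elim=> [//|r IH] rm; have {}IH := IH (ltnW rm).
have hr := h (Ordinal rm); have hr' := h' (Ordinal rm).
rewrite /visited /= IH in hr; rewrite /visited /= in hr'.
by rewrite /= IH /oracle /maxp hr hr' e.
Qed.

(* A row that is not returned in the block is confined to [k] slabs given by
   the exploring queries, which costs it [q] of its [b] bits. *)
Lemma card_explained (c : transcript) :
  (#|[set Am : smat b n | `[< explains Am c >]]| <= 2 ^ ((b - q) * n + q * m))%N.
Proof.
case: (posnP n) => [n0|n0].
  have -> : (2 ^ ((b - q) * n + q * m) = 1)%N.
    by have : m = 0%N by [move: mn n0; clear; lia]; rewrite n0 => ->; rewrite !muln0.
  apply: leq_trans (max_card _) _; rewrite card_ffun card_ord.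
  by rewrite n0.
case: c => [[[mem vs] resp] pos].
pose p0 : 'I_n * bool := (Ordinal n0, true).
pose rowof (r : 'I_m) := (nth p0 (enum {: 'I_n * bool}) (resp r)).1.
pose Rs := rowof @: [set: 'I_m].
have cR : (#|Rs| <= m)%N.
  by apply: leq_trans (leq_imset_card _ _) _; rewrite cardsT card_ord.
(* Rows in [Rs] are free and the others keep [b - q] bits: the exponent is
   [(b - q) * n + q * #|Rs|]. *)
apply: (@leq_trans (#|{ffun 'I_b -> bool}| ^ #|Rs| * 2 ^ ((b - q) * (n - #|Rs|)))); last first.
  rewrite card_ffun card_bool card_ord -expnM -expnD leq_exp2l //.
  by move: cR mn qb; clear; nia.
apply: card_le_fibers => A0; rewrite inE => /asboolP[h0 e0].
pose x (j : 'I_k) := visited A0 mem vs (pos j).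
pose U := \matrix_(j < k, c < b) lo (x j) c.
have cert (j : 'I_k) : exists w : vec b, [/\ dot w w <= 1,
    forall i : 'I_k, (i < j)%N -> dot w (lo (x i)) = 0 & tau <= dot w (lo (x j))].
  by have [_ _] := e0 j.
have [W hW] := choice cert.
pose V i := [set a : {ffun 'I_b -> bool} | [forall j : 'I_k,
   (`|\sum_c U j c * sgb R (a c) + hi (x j) i / (2 * lam)| <= eta)%R]].
have cV i : (#|V i| <= 2 ^ (b - q))%N.
  apply: (card_signs_in_slabs (W := \matrix_(j, c) W j c) (tau := tau) (k := k)) => //.
  - by rewrite eta1 andbT /eta divr_ge0 ?mulr_ge0 // ltW.
  - move=> j c; rewrite mxE; have [_ x2 _] := e0 j.
    by apply: le_trans x2; apply: (abs_coord_le (x j)).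
  - move=> j; have [h _ _] := hW j; apply: le_trans h; rewrite dotE.
    by rewrite le_eqVlt; apply/orP; left; apply/eqP/eq_bigr => c _; rewrite mxE expr2.
  - move=> i' j ij; have [_ h _] := hW j; rewrite -[RHS](h i' ij) dotE.
    by apply: eq_bigr => c _; rewrite !mxE.
  move=> j; have [_ _ h] := hW j; apply: le_trans h _; rewrite dotE.
  by rewrite le_eqVlt; apply/orP; left; apply/eqP/eq_bigr => c _; rewrite !mxE.
pose F i : pred {ffun 'I_b -> bool} := fun a => if i \in Rs then a == A0 i else a \in V i.
apply: (@leq_trans #|family F|).
  apply: subset_leq_card; apply/subsetP => Am; rewrite inE => /andP[].
  rewrite inE => /asboolP[h e] /forall_inP agree.
  have sim := visited_agree h h0.
  have {}sim r : (r < m)%N -> visited Am mem vs r = visited A0 mem vs r.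
    move=> rm; rewrite /visited sim //; last exact: ltnW.
    move=> r'; apply: (@nth_pieces_agree _ _ _ p0).
    by apply/eqP; apply: agree; apply/imsetP; exists r'.
  apply/familyP => i; rewrite unfold_in /F; case: ifP => iRs; first by apply: agree.
  rewrite !inE; apply/forallP => j; have [/(_ i) hr _ _] := e j.
  rewrite sim // in hr.
  have -> : \sum_c U j c * sgb R (Am i c) + hi (x j) i / (2 * lam) =
            row_form lam Am (x j) i / lam.
    have -> : \sum_c U j c * sgb R (Am i c) = dot (svec (Am i)) (lo (x j)).
      by rewrite dotC dotE; apply: eq_bigr => c _; rewrite mxE.
    by rewrite /row_form; field; rewrite gt_eqF.
  rewrite normrM [X in _ * X]gtr0_norm ?invr_gt0 // /eta.
  by apply: ler_wpM2r => //; rewrite invr_ge0 ltW.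
rewrite card_family foldrE big_map /=.
rewrite big_enum /=.
apply: (@leq_trans (\prod_i (if i \in ~: Rs then 2 ^ (b - q) else 1))%N).
  apply: leq_prod => i _; rewrite inE; case: (boolP (i \in Rs)) => iRs /=.
    by rewrite (eq_card (_ : F i =i pred1 (A0 i))) ?card1 // => a; rewrite unfold_in /F iRs.
  by rewrite (eq_card (_ : F i =i V i)) // => a; rewrite unfold_in /F (negbTE iRs).
by rewrite -big_mkcond /= prod_nat_const -expnM cardsCs setCK card_ord.
Qed.

(** Every matrix is explained by some transcript, so [2 ^ (b * n)] is at most the number of
    transcripts times the bound of [card_explained]; then [2 ^ ((b - q) * n)] cancels. *)
Lemma counting p T0 (theta : R) : (0 < p)%N -> (0 < k)%N -> K = (p * k)%N ->
  (T0 <= p * m)%N ->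
  (forall Am, exists vs E t,
     [/\ (t <= T0)%N, @invariant b n G M lam mu gam tau theta A Am t vs E & size E = K]) ->
  (2 ^ (q * n) <= 2 ^ M * (2 * G).+1 ^ (b * K.+1) * (n * 2 + K.+1).+1 ^ m * m ^ k *
                  2 ^ (q * m))%N.
Proof.
move=> p0 k0 KE T0p inv.
have covered Am : exists c : transcript, explains Am c.
  have [vs [E [t [tT0 [szv sp srt tm ex lst st] szE]]]] := inv Am.
  have szE' : size E = (p * k)%N by rewrite szE.
  have ET e : e \in E -> (e < T0)%N by move=> /tm lt; apply: leq_trans lt tT0.
  have [j jp short] := short_block srt szE' p0 k0 ET T0p.
  pose s0 := nth 0%N E (j * k).
  pose mem := memory A (oracle (pcs Am vs)) s0.
  have szv' : size vs == K.+1 by rewrite szv szE.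
  have visE r : visited Am mem vs r = query lam mu gam A Am vs (s0 + r).
    by rewrite /visited /query memory_simulate.
  have inE' (i : 'I_k) : (j * k + i < size E)%N.
    by rewrite szE'; move: (ltn_ord i) jp; clear; nia.
  have s0i (i : 'I_k) : (s0 + i <= nth 0 E (j * k + i))%N by apply: sorted_ltn_ge.
  have posP (i : 'I_k) : (nth 0 E (j * k + i) - s0 < m)%N.
    have le : (nth 0 E (j * k + i) <= nth 0 E (j * k + k.-1))%N.
      have : (i <= k.-1)%N by move: (ltn_ord i) k0; clear; lia.
      rewrite leq_eqVlt => /orP[/eqP->//|lt]; apply/ltnW/nth_sorted_ltn => //.
      rewrite ltn_add2l lt szE' /=; move: jp k0; clear; nia.
    by move: le short (s0i i); rewrite -/s0; clear; lia.
  have respP r : exists i : 'I_(n * 2 + K.+1).+1,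
      best (pcs Am vs) (visited Am mem vs r) = nth (NormPiece (b + n)) (pcs Am vs) i.
    have [i] := best_nth (pcs Am vs) (visited Am mem vs r).
    by rewrite size_pieces (eqP szv') -ltnS => lt ->; exists (Ordinal lt).
  have [resp respE] := choice respP.
  exists (mem, Tuple szv', [ffun r => resp (val r)], [ffun i => Ordinal (posP i)]); split=> /=.
    by move=> r; rewrite ffunE.
  have posE (i : 'I_k) : (s0 + (nth 0 E (j * k + i) - s0) = nth 0 E (j * k + i))%N.
    by rewrite subnKC // (leq_trans _ (s0i i)) // leq_addr.
  move=> i; rewrite ffunE /= visE posE.
  have [e1 e2 [w [w1 w2 w3]]] := ex _ (inE' i).
  split=> //; exists w; split=> // i' ii'.
  by rewrite ffunE /= visE posE w2 // ltn_add2l.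
have cover : (#|smat b n| <= \sum_(c : transcript) 2 ^ ((b - q) * n + q * m))%N.
  apply: (@leq_trans (\sum_(c : transcript) #|[set Am : smat b n | `[< explains Am c >]]|)).
    rewrite -cardsT; apply: (@leq_trans #|\bigcup_(c : transcript) [set Am : smat b n | `[< explains Am c >]]|).
      apply: subset_leq_card; apply/subsetP => Am _; have [c Ac] := covered Am.
      by apply/bigcupP; exists c => //; rewrite inE; apply/asboolP.
    elim/big_rec2: _ => [|c s S _ IH]; first by rewrite cards0.
    by apply: leq_trans (leq_card_setU _ _) _; rewrite leq_add2l.
  by apply: leq_sum => c _; apply: card_explained.
move: cover; rewrite sum_nat_const !card_ffun !card_ord card_bool.
rewrite !card_prod !card_ffun !card_tuple !card_ffun !card_ord card_bool.
have -> : ((2 ^ b) ^ n = 2 ^ ((b - q) * n) * 2 ^ (q * n))%N.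
  by rewrite -expnM -expnD -mulnDl subnK.
rewrite expnD -[(((2 * G).+1 ^ b) ^ K.+1)%N]expnM => cover.
rewrite -(leq_pmul2l (m := 2 ^ ((b - q) * n))) ?expn_gt0 //; apply: leq_trans cover _.
by rewrite mulnCA.
Qed.

End Counting.

(** * Choice of the scales *)

Definition stops_within d M (A : alg d M) (T0 : nat) : Prop :=
  forall f O T, convex_fun f -> lipschitz1 f -> first_order_oracle f O ->
    stops_at A O T -> (T <= T0)%N.

Section Scales.
Variables (b n K M : nat) (A : alg (b + n) M).
Let d := (b + n)%N.
Hypothesis b_gt0 : (0 < b)%N.
Hypothesis bd : (64 * b <= d)%N.

(* [mu * rho / 2 = 2 / d ^ 4] is twice the accuracy; [b * gam <= rho / 4] keeps
   the total offset of the directions below the depth of the minimum. *)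
Let s := Num.sqrt (b%:R : R).
Let r := Num.sqrt (d%:R : R).
Let lam := (2 * s * r)^-1.
Let mu := 16 * s / d%:R ^+ 4.
Let rho := (4 * s)^-1.
Let gam := (16 * b%:R * s)^-1.
Let tau := gam / 8.
Let theta := b%:R * ((d ^ 3)%:R^-1 * 2) : R.

Let d_gt0 : (0 < d)%N. Proof. by apply: leq_trans bd; rewrite muln_gt0. Qed.
Let sB : s ^+ 2 = b%:R. Proof. exact: sqr_sqrtr. Qed.
Let rD : r ^+ 2 = d%:R. Proof. exact: sqr_sqrtr. Qed.
Let s1 : 1 <= s.
Proof. by rewrite -[leLHS]sqrtr1 ler_wsqrtr // ler1n. Qed.
Let r1 : 1 <= r.
Proof. by rewrite -[leLHS]sqrtr1 ler_wsqrtr // ler1n. Qed.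
(** With [v = 1 / d] the conditions on the scales become polynomial in [s], [r] and [v]. *)
Let Dv : exists v, [/\ d%:R = v^-1 :> R, 0 < v & s ^+ 2 * v <= 1 / 64].
Proof.
have D0 : 0 < (d%:R : R) by rewrite ltr0n.
exists d%:R^-1; rewrite invrK invr_gt0; split=> //.
by rewrite sB ler_pdivrMr // div1r mulrC ler_pdivlMr // mulrC -natrM ler_nat.
Qed.

Lemma parameters_adversary T0 (Am : smat b n) : (0 < K)%N -> (2 * K + 2 <= b)%N ->
  minimizes_all A (Rdiv (IZR 1) (pow (INR d) 4)) -> stops_within A T0 ->
  exists vs E t, [/\ (t <= T0)%N,
    @invariant b n (d ^ 3) M lam mu gam tau theta A Am t vs E & size E = K].
Proof.
move=> K0 Kb; rewrite RdivE R1E RpowE INRE => minA stopA.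
have s0 : 0 < s by apply: lt_le_trans s1.
have r0 : 0 < r by apply: lt_le_trans r1.
have [v [DE v0 sv]] := Dv.
have sv' : s * v <= 1 / 64.
  apply: le_trans sv; apply: ler_wpM2r; first exact: ltW.
  by rewrite expr2 -[leLHS]mulr1; apply: ler_wpM2l => //; apply: ltW.
have v64 : v <= 1 / 64.
  by apply: le_trans sv'; rewrite -[leLHS]mul1r; apply: ler_wpM2r => //; apply: ltW.
have sv0 : 0 < s * v by rewrite mulr_gt0.
have v2 : v ^+ 2 <= 1 / 64 * (1 / 64) by rewrite expr2; apply: ler_pM => //; apply: ltW.
have v2p : 0 < v ^+ 2 by rewrite exprn_gt0.
apply: (@adversary b n (d ^ 3) K M lam mu gam rho tau theta A Am
          erefl erefl b_gt0 _ Kb _ _ _ _ _ _ _ _ _ T0 K0 _ minA stopA).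
- by rewrite expn_gt0 d_gt0.
- rewrite -/d -sB -rD /lam le_eqVlt; apply/orP; left; apply/eqP; field.
  by rewrite !gt_eqF.
- rewrite /mu DE exprVn invrK; apply/andP; split.
    by rewrite !mulr_gt0 // exprn_gt0.
  have -> : 16 * s * v ^+ 4 = 16 * ((s * v) * v) * v ^+ 2 by ring.
  have : (s * v) * v <= 1 / 64 * (1 / 64) by apply: ler_pM => //; apply: ltW.
  by nra.
- by rewrite /gam invr_gt0 !mulr_gt0 // ltr0n.
- rewrite /rho invr_gt0 mulr_gt0 //= invf_le1 ?mulr_gt0 //.
  by have := s1; lra.
- rewrite -sB /rho le_eqVlt; apply/orP; left; apply/eqP; field; by rewrite gt_eqF.
- rewrite -sB /gam /rho -sB le_eqVlt; apply/orP; left; apply/eqP; field; by rewrite gt_eqF.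
- rewrite /theta /tau /gam natrX DE -sB exprVn invrK.
  have -> : (16 * s ^+ 2 * s)^-1 / 8 = (128 * s ^+ 3)^-1 by field; rewrite gt_eqF.
  rewrite -[leRHS]mul1r ler_pdivlMr ?mulr_gt0 ?exprn_gt0 //.
  have -> : s ^+ 2 * (v ^+ 3 * 2) * (128 * s ^+ 3) =
            256 * ((s ^+ 2 * v) * (s ^+ 2 * v)) * (s * v) by ring.
  have : s ^+ 2 * v * (s ^+ 2 * v) <= 1 / 64 * (1 / 64).
    by apply: ler_pM => //; apply: mulr_ge0; rewrite ?sqr_ge0 ?ltW.
  by nra.
- rewrite /theta natrX DE -sB exprVn invrK.
  have -> : 16 * s ^+ 2 * (s ^+ 2 * (v ^+ 3 * 2)) =
            32 * ((s ^+ 2 * v) * (s ^+ 2 * v)) * v by ring.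
  have : s ^+ 2 * v * (s ^+ 2 * v) <= 1 / 64 * (1 / 64).
    by apply: ler_pM => //; apply: mulr_ge0; rewrite ?sqr_ge0 ?ltW.
  by nra.
rewrite /mu /rho -/d DE exprVn invrK mul1r.
have -> : 16 * s * v ^+ 4 * (4 * s)^-1 / 2 = 2 * v ^+ 4 by field; rewrite gt_eqF.
by have : 0 < v ^+ 4 by [rewrite exprn_gt0]; lra.
Qed.

(** The [K] exploring times are distinct and below [T0]; any matrix serves. *)
Lemma queries_ge T0 : (0 < K)%N -> (2 * K + 2 <= b)%N ->
  minimizes_all A (Rdiv (IZR 1) (pow (INR d) 4)) -> stops_within A T0 -> (K <= T0)%N.
Proof.
move=> K0 Kb minA stopA.
have [vs [E [t [tT0 [_ _ srt tm _ _ _] szE]]]] :=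
  parameters_adversary [ffun=> [ffun=> true]] K0 Kb minA stopA.
have lt : (0 + K.-1 < size E)%N by rewrite add0n szE prednK.
rewrite -(prednK K0); apply: leq_trans tT0; apply: leq_ltn_trans (tm _ (mem_nth 0%N lt)).
exact: leq_trans (leq_addl _ _) (sorted_ltn_ge srt lt).
Qed.

Lemma memory_queries_tradeoff p q L m :
  (0 < p)%N -> (0 < q)%N -> (0 < L)%N -> (d <= 2 ^ L)%N -> (m <= n)%N ->
  K = (p * (q * L))%N -> (2 * K + 2 <= b)%N ->
  minimizes_all A (Rdiv (IZR 1) (pow (INR d) 4)) -> stops_within A (p * m) ->
  (2 ^ (q * n) <= 2 ^ M * (2 * d ^ 3).+1 ^ (b * K.+1) * (n * 2 + K.+1).+1 ^ m *
                  m ^ (q * L) * 2 ^ (q * m))%N.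
Proof.
move=> p0 q0 L0 dL mn KE Kb minA stopA.
have s0 : 0 < s by apply: lt_le_trans s1.
have r0 : 0 < r by apply: lt_le_trans r1.
have [v [DE v0 sv]] := Dv.
have k0 : (0 < q * L)%N by rewrite muln_gt0 q0.
have kb : (q * L <= b)%N.
  by apply: leq_trans Kb; rewrite KE; move: p0; clear; nia.
have qk : (q <= q * L)%N by rewrite leq_pmulr.
have K0 : (0 < K)%N by rewrite KE muln_gt0 p0.
pose eta := 5 * mu / lam.
have etaE : eta = 160 * s ^+ 2 * r * v ^+ 4.
  by rewrite /eta /mu /lam DE exprVn; field; rewrite !gt_eqF ?exprn_gt0 ?invr_gt0 ?mulr_gt0.
have rv : r ^+ 2 * v = 1 by rewrite rD DE mulVf // gt_eqF.
have rv1 : r * v <= 1.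
  rewrite -rv; apply: ler_wpM2r; first exact: ltW.
  by rewrite expr2 -[leLHS]mulr1; apply: ler_wpM2l => //; apply: ltW.
have v64 : v <= 1 / 64.
  apply: le_trans sv; rewrite -[leLHS]mul1r; apply: ler_wpM2r; first exact: ltW.
  by rewrite sB ler1n.
have svp : 0 < s ^+ 2 * v by rewrite mulr_gt0 ?exprn_gt0.
have eta1 : eta <= 1.
  have -> : eta = 160 * ((s ^+ 2 * v) * (r * v)) * (v * v) by rewrite etaE; ring.
  have h1 : (s ^+ 2 * v) * (r * v) <= 1 / 64 * 1.
    by apply: ler_pM => //; rewrite ltW // mulr_gt0.
  have h2 : v * v <= 1 / 64 * (1 / 64) by apply: ler_pM => //; apply: ltW.
  have h3 : 0 < v * v by rewrite mulr_gt0.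
  by nra.
have eta_v : v ^+ 4 <= eta.
  rewrite etaE -[leLHS]mul1r; apply: ler_wpM2r; first by rewrite exprn_ge0 // ltW.
  have : 1 <= s ^+ 2 * r by rewrite -[leLHS]mul1r; apply: ler_pM; rewrite ?sB ?ler1n.
  by rewrite -mulrA; lra.
have eta0 : 0 < eta by apply: lt_le_trans eta_v; rewrite exprn_gt0.
apply: (@counting b n (d ^ 3) K M m (q * L) q lam mu gam tau A b_gt0 mn qk _ _ _ _ eta1 _
          p (p * m) theta p0 k0 KE (leqnn _)).
- exact: leq_trans qk kb.
- by rewrite /lam invr_gt0 !mulr_gt0.
- by rewrite /mu mulr_gt0 ?invr_gt0 ?exprn_gt0 ?ltr0n // mulr_gt0.
- by rewrite /tau /gam divr_gt0 // invr_gt0 !mulr_gt0 // ltr0n.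
- rewrite -/eta.
  (* The missing [2 * q] factors of [eta >= d ^ -4] cost at most [d ^ (8 * q) <= 256 ^ (q * L)], a
     constant per exploring query; this is why a block has length [q * L]. It then suffices to
     compare bases. *)
  have big : 1 <= 256 ^+ (q * L) * eta ^+ (2 * q).
    have h1 : v^-1 ^+ (8 * q) <= 256 ^+ (q * L).
      rewrite -DE -!natrX ler_nat.
      apply: (@leq_trans ((2 ^ L) ^ (8 * q))); first by rewrite leq_exp2r // muln_gt0.
      by rewrite -[256%N]/(2 ^ 8)%N -!expnM leq_exp2l //; move: q0; clear; nia.
    have h2 : v ^+ (8 * q) <= eta ^+ (2 * q).
      have -> : (8 * q = 4 * (2 * q))%N by rewrite mulnA.
      by rewrite exprM; apply: lerXn2r; rewrite ?nnegrE ?exprn_ge0 // ltW.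
    apply: (@le_trans _ _ (v^-1 ^+ (8 * q) * v ^+ (8 * q))).
      by rewrite -exprMn mulVf ?expr1n // gt_eqF.
    by apply: ler_pM => //; rewrite exprn_ge0 // ?invr_ge0 ltW.
  have e2 : eta ^+ (2 * (q * L - q)) <= (256 * eta ^+ 2) ^+ (q * L).
    have -> : (256 * eta ^+ 2) ^+ (q * L) =
        eta ^+ (2 * (q * L - q)) * (256 ^+ (q * L) * eta ^+ (2 * q)).
      rewrite exprMn -exprM [RHS]mulrCA -exprD; congr (_ * _ ^+ _).
      by move: qk; clear; lia.
    by rewrite -[leLHS]mulr1; apply: ler_wpM2l => //; rewrite exprn_ge0 // ltW.
  apply: (@le_lt_trans _ _ ((4 * (q * L)%:R * b%:R * (256 * eta ^+ 2)) ^+ (q * L))).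
    by rewrite [leRHS]exprMn; apply: ler_wpM2l => //; rewrite exprn_ge0 // !mulr_ge0.
  rewrite [ltRHS]exprM ltr_pXn2r // ?nnegrE ?sqr_ge0 //; last first.
    by apply: mulr_ge0; [rewrite !mulr_ge0 | apply: mulr_ge0 => //; apply: sqr_ge0].
  apply: (@le_lt_trans _ _ (4 * b%:R * b%:R * (256 * eta ^+ 2))).
    apply: ler_wpM2r; first by rewrite mulr_ge0 ?sqr_ge0.
    by apply: ler_wpM2r => //; apply: ler_wpM2l => //; rewrite ler_nat.
  rewrite /tau /gam -sB.
  have -> : ((16 * s ^+ 2 * s)^-1 / 8) ^+ 2 = (16384 * s ^+ 6)^-1 by field; rewrite gt_eqF.
  rewrite -[ltRHS]mul1r ltr_pdivlMr ?mulr_gt0 ?exprn_gt0 //.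
  have -> : 4 * s ^+ 2 * s ^+ 2 * (256 * eta ^+ 2) * (16384 * s ^+ 6) =
    4 * 256 * 160 * 160 * 16384 * (s ^+ 2 * v) ^+ 7 * (r ^+ 2 * v) by rewrite etaE; ring.
  rewrite rv mulr1.
  have : (s ^+ 2 * v) ^+ 7 <= (1 / 64) ^+ 7.
    by apply: lerXn2r; rewrite ?nnegrE ?divr_ge0 //; exact: ltW.
  by lra.
by move=> Am; apply: parameters_adversary.
Qed.

End Scales.

(** * Elimination of the auxiliary parameters *)

Lemma linear_query_bound d M (A : alg d M) T0 : (1000 <= d)%N ->
  minimizes_all A (Rdiv (IZR 1) (pow (INR d) 4)) -> stops_within A T0 ->
  (d <= 512 * T0)%N.
Proof.
move=> d1000; set b := (d %/ 64)%N.
have [n dE] : exists n, d = (b + n)%N.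
  by exists (d - b)%N; rewrite subnKC // leq_div.
have bd : (64 * b <= d)%N by rewrite mulnC leq_divM.
have bd' : (d < 64 * b.+1)%N by rewrite mulnC ltn_ceil.
move: b dE bd bd' => b dE; subst d => bd bd' minA stopA.
(* [K] is about [d / 256]; the constant 512 absorbs the two roundings. *)
have KT : (b %/ 4 <= T0)%N.
  apply: (queries_ge _ _ _ _ minA stopA) => //; move: bd' d1000; clear.
  - by lia.
  - by lia.
  by lia.
by move: bd' KT d1000; clear; lia.
Qed.

Lemma leq_expn2l m n e : (m <= n)%N -> (m ^ e <= n ^ e)%N.
Proof. by case: e => // e mn; rewrite leq_exp2r. Qed.

(** Base 2 logarithm of the counting bound: [2 * d ^ 3 + 1 <= 2 ^ (5 * L)] and
    [n * 2 + K + 2 <= 2 ^ (3 * L)]. *)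
Lemma exponent_bound d n K M L q m b :
  (0 < L)%N -> (0 < d)%N -> (d <= 2 ^ L)%N -> (K.+2 <= 2 * d)%N -> (n <= d)%N -> (m <= n)%N ->
  (2 ^ (q * n) <= 2 ^ M * (2 * d ^ 3).+1 ^ (b * K.+1) * (n * 2 + K.+1).+1 ^ m *
                  m ^ (q * L) * 2 ^ (q * m))%N ->
  (q * n <= M + 5 * L * (b * K.+1) + 3 * L * m + L * (q * L) + q * m)%N.
Proof.
move=> L0 d0 dL Kd nd mn h; rewrite -(leq_exp2l _ _ (isT : 1 < 2)%N).
apply: leq_trans h _; rewrite !expnD.
apply: leq_mul => //; apply: leq_mul; last first.
  rewrite [leqRHS]expnM; apply: leq_expn2l; exact: leq_trans mn (leq_trans nd dL).
apply: leq_mul; last first.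
  rewrite [leqRHS]expnM; apply: leq_expn2l.
  apply: (@leq_trans (2 ^ (2 + L))); last by rewrite leq_exp2l //; move: L0; clear; lia.
  by rewrite expnD; move: Kd nd dL; clear; lia.
apply: leq_mul => //; rewrite [leqRHS]expnM; apply: leq_expn2l.
apply: (@leq_trans (2 ^ (2 + L * 3))); last by rewrite leq_exp2l //; move: L0; clear; lia.
apply: (@leq_trans (4 * d ^ 3)); last by rewrite expnD expnM leq_mul2l leq_exp2r.
by have : (0 < d ^ 3)%N by [rewrite expn_gt0 d0]; clear; lia.
Qed.

(** In units of [d * q / 16], the five terms of [exponent_bound] are at most 1, 4, 3, 1 and 1,
    whereas [q * n] is at least 63/64 of [d * q]. *)
Lemma no_tradeoff d M (A : alg d M) p q L :
  (0 < p)%N -> (0 < q)%N -> (0 < L)%N -> (d <= 2 ^ L)%N ->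
  (16 * M <= d * q)%N -> (160 * L ^ 3 * p ^ 2 * q <= d)%N -> (16 * L ^ 2 <= d)%N ->
  (64 * (2 * (p * (q * L)) + 2) <= d)%N ->
  minimizes_all A (Rdiv (IZR 1) (pow (INR d) 4)) ->
  ~ stops_within A (p * (d %/ (16 * L))).
Proof.
set K := (p * (q * L))%N; set b := (2 * K + 2)%N; set m := (d %/ (16 * L))%N.
move=> p0 q0 L0 dL hM hp hL bd minA stopA.
have Lm : (16 * L * m <= d)%N by rewrite mulnC leq_divM.
have K1 : (0 < K)%N by rewrite !muln_gt0 p0 q0.
have [n dE] : exists n, d = (b + n)%N.
  by exists (d - b)%N; rewrite subnKC //; move: bd; clear; lia.
have mn : (m <= n)%N.
  have : (16 * m <= 16 * L * m)%N by rewrite leq_mul2r leq_pmulr ?orbT.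
  by move: Lm bd dE; clear; lia.
have b0 : (0 < b)%N by rewrite /b addnC.
have d0 : (0 < d)%N by rewrite dE addn_gt0 b0.
have tr : (q * n <= M + 5 * L * (b * K.+1) + 3 * L * m + L * (q * L) + q * m)%N.
  apply: (@exponent_bound d) => //.
  - by move: bd K1; rewrite /b; clear; lia.
  - by rewrite dE leq_addl.
  have Kb : (2 * K + 2 <= b)%N by [].
  clearbody m b; subst d.
  exact: (@memory_queries_tradeoff b n K M A b0 bd p q L m p0 q0 L0 dL mn erefl Kb minA stopA).
have e1 : (5 * L * (b * K.+1) * 4 <= d * q)%N.
  apply: (@leq_trans ((160 * L ^ 3 * p ^ 2 * q) * q)); last by rewrite leq_mul2r hp orbT.
  have -> : (160 * L ^ 3 * p ^ 2 * q * q = 160 * L * K ^ 2)%N by rewrite /K; ring.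
  have : (L * (K.+1 * K.+1) <= L * (4 * (K * K)))%N.
    by rewrite leq_mul2l; apply/orP; right; move: K1; clear; nia.
  by rewrite /b; clear; nia.
have e2 : (16 * (L * (q * L)) <= d * q)%N.
  by have : (16 * L ^ 2 * q <= d * q)%N by [rewrite leq_mul2r hL orbT]; clear; nia.
have e3 : (16 * (L * m) <= d * q)%N.
  by apply: (@leq_trans d); [rewrite mulnA | rewrite leq_pmulr].
have e4 : (16 * (q * m) <= d * q)%N.
  rewrite [(d * q)%N]mulnC mulnCA leq_mul2l; apply/orP; right.
  apply: leq_trans Lm; rewrite leq_mul2r; apply/orP; right.
  by rewrite leq_pmulr.
have e5 : (64 * (q * n) + d * q >= 64 * (d * q))%N.
  have : (q * (64 * b) <= q * d)%N by rewrite leq_mul2l bd orbT.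
  by move: dE; clear; nia.
have dq : (0 < d * q)%N by rewrite muln_gt0 d0.
by move: tr hM e1 e2 e3 e4 e5 dq; clear; lia.
Qed.
Lemma ln_nondecreasing (x y : R) : Rlt R0 x -> Rle x y -> Rle (ln x) (ln y).
Proof.
move=> x0 [xy|->]; last exact: Rle_refl.
by left; apply: ln_increasing.
Qed.

Lemma ln_lower (d L : nat) : (3 <= d)%N -> (2 ^ L <= d)%N ->
  1 <= ln (INR d) /\ L.+1%:R <= 3 * ln (INR d).
Proof.
move=> d3 Ld.
have d3' : Rle (IZR 3) (INR d) by rewrite -(INR_IZR_INZ 3); apply: le_INR; apply/ssrnat.leP.
have l1 : 1 <= ln (INR d).
  apply/RleP; rewrite -[X in Rle X _](ln_exp 1); apply: ln_nondecreasing; first exact: exp_pos.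
  exact: Rle_trans exp_le_3 d3'.
have l2 : 1 / 2 <= ln 2.
  by rewrite div1r; apply/ltW/RltP/ln_lt_2.
have : Rle (ln (pow 2 L)) (ln (INR d)).
  apply: ln_nondecreasing; first by apply: pow_lt; apply/RltP.
  by apply/RleP; rewrite RpowE INRE -natrX ler_nat.
rewrite ln_pow; last by apply/RltP.
move/RleP; rewrite RmultE INRE => h; split=> //.
have : L%:R * (1 / 2) <= L%:R * ln 2 by apply: ler_wpM2l.
by rewrite -(natr1 L); lra.
Qed.

Lemma nat_ceil (x : R) : 1 <= x -> exists p : nat, [/\ (0 < p)%N, x <= p%:R & p%:R <= x + 1].
Proof.
move=> x1; have x0 : 0 <= x by lra.
have /andP[h1 h2] := truncn_itv x0.
exists (Num.truncn x).+1; split=> //; first exact: ltW.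
by rewrite -natr1; lra.
Qed.
(* Used with [y = d ^ (delta / 3)] and [D = d ^ (1 - delta)]; for [y] below a
   power of [ln d] the bound linear in [d] suffices. *)
Lemma query_lower_bound d M (A : alg d M) (y D l : R) :
  (1000 <= d)%N -> 1 <= y -> 1 <= D -> y ^+ 3 * D = d%:R -> l = ln (INR d) ->
  minimizes_all A (Rdiv (IZR 1) (pow (INR d) 4)) -> M%:R < d%:R * D ->
  ~ (forall f O T, convex_fun f -> lipschitz1 f -> first_order_oracle f O ->
       stops_at A O T -> T%:R < (10 ^ 9)%:R^-1 * (d%:R * y) / l ^+ 3).
Proof.
move=> d1000 y1 D1 yD lE minA MD fast.
have within T0 : (10 ^ 9)%:R^-1 * (d%:R * y) / l ^+ 3 <= T0.+1%:R -> stops_within A T0.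
  move=> le f O T cf lf fo sT; rewrite leqNgt; apply/negP => lt.
  have := lt_le_trans (fast f O T cf lf fo sT) le; rewrite ltr_nat ltnS leqNgt.
  by rewrite lt.
set L := (trunc_log 2 d).+1.
have d0 : (0 < d)%N by apply: leq_trans d1000.
have dL : (d <= 2 ^ L)%N by rewrite ltnW // trunc_log_ltn.
have Ld : (2 ^ trunc_log 2 d <= d)%N by apply: trunc_logP.
have [l1 Ll] := ln_lower (leq_trans (isT : (3 <= 1000)%N) d1000) Ld.
rewrite -/L -lE in l1 Ll.
have L1 : 1 <= L%:R :> R by rewrite ler1n.
have l3 : 0 < l ^+ 3 by rewrite exprn_gt0 //; lra.
have l3l : l <= l ^+ 3.
  by rewrite exprS -[leLHS]mulr1; apply: ler_wpM2l; rewrite ?exprn_ege1 //; lra.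
have d0' : 0 < (d%:R : R) by rewrite ltr0n.
have cE : (10 ^ 9)%:R = 10 ^+ 9 :> R by rewrite natrX.
(* The threshold is [160 * 2 ^ 2 * 17 * L ^ 3], as needed with [p <= 2 * y] and [q <= 17 * D]. Below
   it, [y] is of order [l ^ 3], whence the third power of the logarithm. *)
have [ysmall|ybig] := ltrP y (64 * 170 * L%:R ^+ 3).
  have st : stops_within A (d.-1 %/ 512).
    apply: within; apply: (@le_trans _ _ (d%:R / 512)).
      rewrite cE ler_pdivrMr // mulrC ler_pdivrMr ?exprn_gt0 //.
      have yl : y <= 27 * (64 * 170) * l ^+ 3.
        apply: ltW; apply: lt_le_trans ysmall _.
        have : L%:R ^+ 3 <= (3 * l) ^+ 3 by apply: lerXn2r; rewrite ?nnegrE //; lra.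
        by rewrite exprMn; lra.
      have : d%:R * y <= d%:R * (27 * (64 * 170) * l ^+ 3) by apply: ler_wpM2l.
      have : 0 <= d%:R * l ^+ 3 by rewrite mulr_ge0 // ltW.
      by lra.
    rewrite ler_pdivrMr // -natrM ler_nat.
    by have := ltn_ceil d.-1 (isT : (0 < 512)%N); move: d0; clear; lia.
  have := linear_query_bound d1000 minA st.
  by have := leq_divM d.-1 512; move: d0; clear; lia.
have [p [p0 py py1]] := nat_ceil y1.
(* The factor 16 turns [M < d * D] into [16 * M <= d * q]. *)
have [q [q0 qD qD1]] : exists q : nat, [/\ (0 < q)%N, 16 * D <= q%:R & q%:R <= 16 * D + 1].
  by apply: nat_ceil; lra.
have p2 : p%:R <= 2 * y by lra.
have q17 : q%:R <= 17 * D by lra.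
have L3 : 1 <= L%:R ^+ 3 :> R by rewrite exprn_ege1.
have L2 : L%:R ^+ 2 <= L%:R ^+ 3 :> R by rewrite ler_weXn2l.
have LL : L%:R <= L%:R ^+ 2 :> R by rewrite expr2 -[leLHS]mulr1; apply: ler_wpM2l.
have y2 : y <= y ^+ 2 by rewrite expr2 -[leLHS]mulr1; apply: ler_wpM2l => //; lra.
have yd : y <= d%:R.
  have -> : y = y * 1 * 1 by ring.
  rewrite -yD exprS; apply: ler_pM; rewrite ?mulr1 //; try lra.
  by rewrite -[leLHS]mulr1; apply: ler_wpM2l; [lra|rewrite exprn_ege1].
have yD0 : 0 <= y * D by rewrite mulr_ge0; lra.
apply: (@no_tradeoff d M A p q L p0 q0 _ dL _ _ _ _ minA) => //.
- rewrite -(ler_nat R) !natrM.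
  have : d%:R * (16 * D) <= d%:R * q%:R by apply: ler_wpM2l.
  by lra.
- rewrite -(ler_nat R) 3!natrM 2!natrX -yD.
  have h1 : p%:R ^+ 2 * q%:R <= (2 * y) ^+ 2 * (17 * D).
    by apply: ler_pM => //; rewrite ?sqr_ge0 //; apply: lerXn2r; rewrite ?nnegrE //; lra.
  have h2 : 160 * L%:R ^+ 3 * (p%:R ^+ 2 * q%:R) <= 160 * L%:R ^+ 3 * ((2 * y) ^+ 2 * (17 * D)).
    by apply: ler_wpM2l => //; lra.
  have h3 : (64 * 170 * L%:R ^+ 3) * (y ^+ 2 * D) <= y * (y ^+ 2 * D).
    by apply: ler_wpM2r => //; rewrite mulr_ge0 ?sqr_ge0 //; lra.
  have -> : y ^+ 3 * D = y * (y ^+ 2 * D) by ring.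
  by rewrite -mulrA; apply: le_trans h2 _; apply: le_trans h3; lra.
- by rewrite -(ler_nat R) natrM natrX; lra.
- rewrite -(ler_nat R) natrM natrD natrM !natrM -yD.
  have h1 : p%:R * (q%:R * L%:R) <= (2 * y) * ((17 * D) * L%:R).
    by do 2 (apply: ler_pM; rewrite ?mulr_ge0 //).
  have h2 : 1 <= p%:R * (q%:R * L%:R) :> R by rewrite -!natrM ler1n !muln_gt0 p0 q0.
  have h3 : (64 * 136 * L%:R) * (y * D) <= y ^+ 2 * (y * D) by apply: ler_wpM2r => //; lra.
  have -> : y ^+ 3 * D = y ^+ 2 * (y * D) by ring.
  by apply: le_trans h3; lra.
set m := (d %/ (16 * L))%N.
apply: within.
have hm : d%:R <= 16 * L%:R * (m%:R + 1) :> R.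
  rewrite natr1 -!natrM ler_nat ltnW // mulnC /m ltn_ceil // muln_gt0.
have hm2 : d%:R <= 32 * L%:R * m%:R :> R by lra.
(* The excluded number of queries [p * m] is of order [d * y / L]. *)
have hpm : y * d%:R <= 32 * L%:R * (p%:R * m%:R).
  apply: (@le_trans _ _ (p%:R * (32 * L%:R * m%:R))); last by lra.
  by apply: ler_pM => //; lra.
rewrite cE ler_pdivrMr // mulrC ler_pdivrMr ?exprn_gt0 // -natr1 natrM.
set P := p%:R * m%:R in hpm *.
have P0 : 0 <= P by rewrite mulr_ge0.
have h1 : L%:R * P <= 3 * l * P by apply: ler_wpM2r.
have h2 : l * P <= l ^+ 3 * P by apply: ler_wpM2r.
have h3 : 0 <= l ^+ 3 * P by rewrite mulr_ge0 // ltW.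
lra.
Qed.

Lemma Rpower_ge1 (x e : R) : Rle 1 x -> Rle 0 e -> 1 <= Rpower x e.
Proof.
move=> x1 e0; apply/RleP; rewrite -[X in Rle X _](Rpower_O x); first exact: Rle_Rpower.
by apply: Rlt_le_trans x1; apply: Rlt_0_1.
Qed.

(** Real operations are spelled by their standard library names because [ring_scope] is open
    here. *)
Lemma tradeoff :
  exists (c : R) (k d0 : nat), Rlt R0 c /\
  forall d : nat, (d0 <= d)%N ->
  forall delta : R, Rle R0 delta /\ Rle delta R1 ->
  forall (M : nat) (A : alg d M),
    minimizes_all A (Rdiv (IZR 1) (pow (INR d) 4)) ->
    Rge (INR M) (Rpower (INR d) (Rminus (IZR 2) delta)) \/
    exists (f : vec d -> R) (Q : vec d -> R * vec d) (T : nat),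
      convex_fun f /\ lipschitz1 f /\ first_order_oracle f Q /\
      stops_at A Q T /\
      Rle (Rdiv (Rmult c (Rpower (INR d) (Rplus (IZR 1) (Rdiv delta (IZR 3)))))
                (pow (ln (INR d)) k)) (INR T).
Proof.
exists (10 ^ 9)%:R^-1, 3%N, 1000%N; split.
  by apply/RltP; rewrite invr_gt0 ltr0n expn_gt0.
move=> d d1000 delta [delta0 delta1] M A minA.
case: (Rge_dec (INR M) (Rpower (INR d) (Rminus (IZR 2) delta))) => [|/Rnot_ge_lt/RltP small].
  by left.
right; apply: contrapT => none.
have x1 : Rle R1 (INR d).
  by apply/RleP; rewrite INRE ler1n (leq_trans _ d1000).
have x0 : Rlt R0 (INR d) := Rlt_le_trans _ _ _ Rlt_0_1 x1.
have three : Rmult (IZR 3) (Rdiv delta (IZR 3)) = delta.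
  by rewrite Rmult_comm /Rdiv Rmult_assoc Rinv_l ?Rmult_1_r //; apply: not_0_IZR.
set y := Rpower (INR d) (Rdiv delta (IZR 3)).
set D := Rpower (INR d) (Rminus (IZR 1) delta).
have y1 : 1 <= y.
  apply: Rpower_ge1 => //; apply: Rle_mult_inv_pos => //.
  by apply: IZR_lt.
have D1 : 1 <= D.
  by apply: Rpower_ge1 => //; apply: Rge_le; apply: Rge_minus; apply: Rle_ge.
have yD : y ^+ 3 * D = d%:R.
  have -> : y ^+ 3 = Rpower (INR d) delta.
    rewrite -RpowE -Rpower_pow; last by apply/RltP; apply: lt_le_trans y1.
    rewrite /y Rpower_mult; congr (Rpower _ _).
    by rewrite Rmult_comm -[RHS]three; congr (Rmult _ _); rewrite INR_IZR_INZ.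
  rewrite -RmultE -Rpower_plus -INRE -[RHS](Rpower_1 _ x0); congr (Rpower _ _).
  by rewrite Rplus_minus.
have MD : M%:R < d%:R * D.
  rewrite -!INRE -[INR d in X in _ < X](Rpower_1 _ x0) /D -RmultE -Rpower_plus.
  apply: lt_le_trans small _; rewrite le_eqVlt; apply/orP; left; apply/eqP.
  congr (Rpower _ _); rewrite -[IZR 2]/(Rplus R1 R1); rewrite RminusE RplusE RminusE RplusE.
  by rewrite addrA.
apply: (query_lower_bound d1000 y1 D1 yD erefl minA MD) => f Q T cf lf fo sT.
rewrite ltNge; apply/negP => le; apply: none; exists f, Q, T; do 4 (split=> //).
apply/RleP; rewrite Rpower_plus Rpower_1 // -/y RdivE RpowE !RmultE.
by rewrite -INRE -(INRE T) in le.
Qed.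

End Tradeoff.

Bind Scope R_scope with R.
Local Open Scope R_scope.

Theorem theorem1 :
  exists (c : R) (k d0 : nat), 0 < c /\
  forall (d : nat), (d0 <= d)%nat ->
  forall (delta : R), 0 <= delta <= 1 ->
  forall (M : nat) (A : alg d M),
    minimizes_all A (1 / (INR d ^ 4)) ->
    INR M >= Rpower (INR d) (2 - delta) \/
    exists (f : vec d -> R) (O : vec d -> R * vec d) (T : nat),
      convex_fun f /\ lipschitz1 f /\ first_order_oracle f O /\
      stops_at A O T /\
      c * Rpower (INR d) (1 + delta / 3) / (ln (INR d)) ^ k <= INR T.
Proof. exact: Tradeoff.tradeoff. Qed.
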